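(* For integers $n,q\ge1$ and $\varepsilon>0$ let $E_{n,q,\varepsilon}$ be the ellipsoid $$E_{n,q,\varepsilon}=\Big\{(x_1,\dots,x_{n+q})\in\mathbb{R}^{n+q}:\ \sum_{1\le j\le n+q}(x_j/a_j)^2\le1\Big\},$$ where $a_j=1$ for $1\le j\le n$ and $a_j=\varepsilon$ for $n+1\le j\le n+q$. (1) Let $q\in\mathbb{Z}$ with $5\le q<\infty$. If $n$ is large enough, $n\ge N(q)$, and $\varepsilon$ is small enough, $0<\varepsilon\le\varepsilon(n,q)$, then the Steiner polynomial $S_{E_{n,q,\varepsilon}}^{\mathbb{R}^{n+q}}$ is not dissipative: some of its roots are situated in the open right half plane. (2) Let $p,q\in\mathbb{Z}$ be such that $q$ is odd, $p\ge1$, $q\ge1$, $p+q\ge6$. If $n$ is large enough, $n\ge N(p,q)$, and $\varepsilon$ is small enough, $0<\varepsilon\le\varepsilon(n,p,q)$, then the Weyl polynomial $W^p_{\partial E_{n,q,\varepsilon}}$ is not conservative: some of its roots do not belong to the imaginary axis.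
   Context: $B^m$ is the closed unit ball of $\mathbb{R}^m$. For a compact convex set $V\subset\mathbb{R}^m$, the Steiner polynomial is the polynomial satisfying $S_V^{\mathbb{R}^m}(t)=\mathrm{Vol}_m(V+tB^m)=\sum_{k=0}^m s_k(V)t^k$ for all real $t\ge0$; it is considered for complex $t$. The Weyl coefficients of the $(m-1)$-dimensional surface $\partial V$ are $w_{2l}(\partial V)=2^l\frac{\Gamma(l+\frac12+1)}{\Gamma(\frac12+1)}s_{2l+1}(V)$, $0\le l\le[\frac{m-1}{2}]$, and the Weyl polynomial of index $p$ is $W_{\partial V}^{p}(t)=\sum_{l=0}^{[(m-1)/2]}\frac{2^{-l}\Gamma(\frac p2+1)}{\Gamma(\frac p2+l+1)}w_{2l}(\partial V)t^{2l}$. A polynomial is dissipative if all its roots lie in $\{z:\mathrm{Re}\,z<0\}$; it is conservative if all its roots are purely imaginary and simple. $N(q)$, $N(p,q)$ denote numbers depending only on the indicated parameters, and $\varepsilon(n,q)>0$, $\varepsilon(n,p,q)>0$ positive numbers depending only on the indicated parameters. *)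

(* Defs.v *)
From HB Require Import structures.
From mathcomp Require Import all_boot all_order all_algebra.
From mathcomp Require Import all_classical all_reals all_analysis.
From mathcomp Require Import complex.

Set Implicit Arguments.
Unset Strict Implicit.
Unset Printing Implicit Defensive.

Import Order.TTheory GRing.Theory Num.Theory.

Local Open Scope classical_set_scope.
Local Open Scope ring_scope.

(* Lebesgue measure on R^m, on the Borel sigma-algebra of [m.-tuple R]: the
   measure on (m+1)-tuples is the image of the product measure
   [lebesgue_measure \x lebesgue_tuple m] under (x, t) |-> x :: t. *)

Section lebesgue_tuple.
Context {R : realType}.

Local Notation RT := (measurableTypeR R).

Definition cons_pair (m : nat) (p : RT * m.-tuple RT) : m.+1.-tuple RT :=
  [tuple of p.1 :: p.2].

Lemma measurable_cons_pair (m : nat) :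
  measurable_fun [set: RT * m.-tuple RT] (@cons_pair m).
Proof. exact: measurable_cons measurable_fst measurable_snd. Qed.

Section successor.
Variables (m : nat) (mu : {sigma_finite_measure set (m.-tuple RT) -> \bar R}).

Definition lebesgue_cons : set (m.+1.-tuple RT) -> \bar R :=
  pushforward (lebesgue_measure \x mu)%E (@cons_pair m).

Let cons0 : lebesgue_cons set0 = 0%E.
Proof. by rewrite /lebesgue_cons /pushforward preimage_set0 measure0. Qed.

Let nu : {measure set (RT * m.-tuple RT) -> \bar R} :=
  (lebesgue_measure \x mu)%E.

Let cons_ge0 A : (0 <= lebesgue_cons A)%E.
Proof. exact: (measure_ge0 nu). Qed.

Let cons_sigma_additive : semi_sigma_additive lebesgue_cons.
Proof.
move=> F mF tF mUF; rewrite /lebesgue_cons /pushforward preimage_bigcup.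
apply: (@measure_semi_sigma_additive _ _ _ nu).
- by move=> n; rewrite -[X in measurable X]setTI; exact: measurable_cons_pair.
- apply/trivIsetP => /= i j _ _ ij; rewrite -preimage_setI.
  by move/trivIsetP : tF => /(_ _ _ _ _ ij) ->//; rewrite preimage_set0.
- rewrite -preimage_bigcup -[X in measurable X]setTI.
  exact: measurable_cons_pair.
Qed.

HB.instance Definition _ := isMeasure.Build _ _ _ lebesgue_cons
  cons0 cons_ge0 cons_sigma_additive.

Let cons_sigma_finite : sigma_finite setT lebesgue_cons.
Proof.
have /sigma_finiteP[F [TF ndF Foo]] := sigma_finiteT (@lebesgue_measure R).
have /sigma_finiteP[G [TG ndG Goo]] := sigma_finiteT mu.
exists (fun n => [set t | F n (thead t) /\ G n [tuple of behead t]]).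
  apply/esym/seteqP; split => // t _.
  have [i _ Fi] : (\bigcup_n F n) (thead t) by rewrite -TF.
  have [j _ Gj] : (\bigcup_n G n) [tuple of behead t] by rewrite -TG.
  exists (maxn i j) => //; split.
  - by move: Fi; exact/subsetPset/ndF/leq_maxl.
  - by move: Gj; exact/subsetPset/ndG/leq_maxr.
move=> n; have [mF Fnoo] := Foo n; have [mG Gnoo] := Goo n; split.
  apply: measurableI.
  - by rewrite -[X in measurable X]setTI; exact: measurable_tnth.
  - by rewrite -[X in measurable X]setTI; exact: measurable_behead.
rewrite /lebesgue_cons /pushforward [X in (_ X < _)%E](_ : _ = F n `*` G n).
  rewrite product_measure1E// lte_mul_pinfty// ge0_fin_numE//.
have tlK p : [tuple of behead (@cons_pair m p)] = p.2 by exact/val_inj.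
by apply/seteqP; split => p /=; rewrite tlK.
Qed.

HB.instance Definition _ := Measure_isSigmaFinite.Build _ _ _ lebesgue_cons
  cons_sigma_finite.

End successor.

Fixpoint lebesgue_tuple (m : nat) :
    {sigma_finite_measure set (m.-tuple RT) -> \bar R} :=
  match m with
  | 0 => dirac [tuple]
  | m'.+1 => lebesgue_cons (lebesgue_tuple m')
  end.

End lebesgue_tuple.

Section geometry.
Context {R : realType}.

Definition volume (m : nat) (A : set 'rV[R]_m) : \bar R :=
  lebesgue_tuple m [set t | A (\row_i tnth t i)].

(* The canonical norm of ['rV[R]_m] is the sup norm, hence the explicit sum. *)
Definition unit_ball (m : nat) : set 'rV[R]_m :=
  [set x | \sum_(j < m) x 0 j ^+ 2 <= 1].
Arguments unit_ball m _ : clear implicits.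

Definition minkowski_add (m : nat) (A B : set 'rV[R]_m) : set 'rV[R]_m :=
  [set a + b | a in A & b in B].

Definition dilation (m : nat) (t : R) (A : set 'rV[R]_m) : set 'rV[R]_m :=
  [set t *: a | a in A].

(* s_k(V) is the coefficient S`_k. *)
Definition is_steiner_polynomial (m : nat) (V : set 'rV[R]_m) (S : {poly R}) :=
  (size S <= m.+1)%N /\
  forall t : R, 0 <= t ->
    volume (minkowski_add V (dilation t (unit_ball m))) = (S.[t])%:E.

Lemma steiner_polynomial_unique (m : nat) (V : set 'rV[R]_m) (S S' : {poly R}) :
  is_steiner_polynomial V S -> is_steiner_polynomial V S' -> S = S'.
Proof.
move=> [_ VS] [_ VS']; apply/eqP; rewrite -subr_eq0; apply/eqP.
pose rs := [seq k%:R : R | k <- iota 0 (size (S - S'))].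
apply: (@roots_geq_poly_eq0 _ _ rs).
- apply/allP => _ /mapP[k _ ->]; apply/rootP.
  rewrite hornerD hornerN; have /eqP : (S.[k%:R])%:E = (S'.[k%:R])%:E :> \bar R.
    by rewrite -VS ?ler0n// -VS' ?ler0n.
  by rewrite eqe => /eqP ->; rewrite subrr.
- by rewrite map_inj_uniq ?iota_uniq//; exact: mulrIn (oner_neq0 _).
- by rewrite size_map size_iota.
Qed.

Definition Gamma (x : R) : R :=
  \int[lebesgue_measure]_(t in `]0, +oo[) (t `^ (x - 1) * expR (- t)).

(* The Weyl coefficient w_{2l} of the boundary of V, for S the Steiner
   polynomial of V. *)
Definition weyl_coef (S : {poly R}) (l : nat) : R :=
  2 ^+ l * (Gamma (l%:R + 2^-1 + 1) / Gamma (2^-1 + 1)) * S`_(2 * l).+1.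

Definition is_weyl_polynomial (m p : nat) (V : set 'rV[R]_m) (W : {poly R}) :=
  exists2 S, is_steiner_polynomial V S &
    W = \sum_(l < (m.-1)./2.+1)
          (2 ^- l * Gamma (p%:R / 2 + 1) / Gamma (p%:R / 2 + l%:R + 1)
           * weyl_coef S l) *: 'X^(2 * l).

Definition ellipsoid (n q : nat) (eps : R) : set 'rV[R]_(n + q) :=
  let a (j : 'I_(n + q)) := if (j < n)%N then 1 else eps in
  [set x | \sum_(j < n + q) (x 0 j / a j) ^+ 2 <= 1].
Arguments ellipsoid n q eps _ : clear implicits.

Definition poly_to_complex (P : {poly R}) : {poly R[i]} :=
  map_poly (real_complex R) P.

Definition dissipative (P : {poly R[i]}) :=
  forall z, root P z -> complex.Re z < 0.

Definition conservative (P : {poly R[i]}) :=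
  forall z, root P z -> complex.Re z = 0 /\ mup z P = 1%N.

End geometry.

Arguments unit_ball {R} m _.
Arguments ellipsoid {R} n q eps _.

(* Main.v *)
Require Import Defs.
From mathcomp Require Import all_boot all_order all_algebra.
From mathcomp Require Import all_classical all_reals all_analysis.
From mathcomp Require Import measurable_realfun qpoly.
From mathcomp Require Import lra ring zify.
From mathcomp Require Import complex.

(* As eps -> 0 the body E + t B is squeezed between the parallel bodies of
   the degenerate ellipsoid B^n x 0^q of radii t and t + eps, so the coefficients
   of the Steiner polynomial converge to those of
     vol(B^n x 0^q + t B^(n+q)) =
       vol(B^n) sum_k C(n,k) t^(k+q) int_(B^q) (1 - |y|^2)^(k/2) dy,
   and roots of the limit are limits of roots.  For even k = 2j the integral is,
   up to a constant, gamma_ratio q j = j! Gamma(q/2+1) / Gamma(j+q/2+1).  If all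
   roots of the limit were in Re <= 0, then by Hermite-Biehler all roots of
     G_(n,r)(z) = sum_j C(n,2j) gamma_ratio r j z^j
   would be real and nonpositive for r = q.  The Weyl polynomial of index p tends
   to a constant times t^(q-1) G_(n,p+q-1)(t^2), so both parts follow once
   G_(n,r) has a root outside (-oo, 0] for r >= 5 and n large.  Since
   (1 + (2/r) z d/dz) G_(n,r) = G_(n,r-2) and this operator preserves
   polynomials with only nonpositive roots, r can be reduced to 5 or 6.  There, as
   n -> oo, G_(n,r)(z/n^2) tends to an entire function that violates Laguerre's
   inequality f f'' <= f'^2 at z = -256, as a numerical evaluation shows. *)

Set Implicit Arguments.
Unset Strict Implicit.
Unset Printing Implicit Defensive.

Import Order.TTheory GRing.Theory Num.Theory.
Import numFieldNormedType.Exports.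

Local Open Scope classical_set_scope.
Local Open Scope ring_scope.

(** * Location of roots of complex polynomials *)

Section complex_roots.
Variable C : numClosedFieldType.
Implicit Types (p : {poly C}) (s : seq C) (w x z : C).

Lemma root_factors p : p != 0 -> exists s,
  p = lead_coef p *: \prod_(z <- s) ('X - z%:P) /\ forall z, root p z = (z \in s).
Proof.
move=> p0; have [s ps] := closed_field_poly_normal p; exists s; split=> // z.
by rewrite {1}ps rootZ ?lead_coef_eq0// root_prod_XsubC.
Qed.

(** The quotient [w q'(w) / q(w)] is the sum of the [w / (w - z)]. For real [z <= 0] such a term
    equals [(|w|^2 - z w) / |w - z|^2], a nonnegative constant plus a nonnegative multiple of
    [w]. *)
Lemma log_deriv_npos s w : {in s, forall z, z <= 0} -> w \notin s ->
  exists A B, [/\ 0 <= A, 0 <= B &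
    let q := \prod_(z <- s) ('X - z%:P) in w * q^`().[w] = q.[w] * (A + B * w)].
Proof.
elim: s => [|z s IHs] s0 ws.
  by exists 0, 0; rewrite /= big_nil -polyC1 derivC horner0 mulr0 mul0r addr0 mulr0.
move: ws; rewrite inE negb_or => /andP[wz ws].
have z0 : z <= 0 by apply: s0; rewrite mem_head.
have {IHs} [|A [B [A0 B0 /= AB]]] := IHs _ ws.
  by move=> y ys; apply: s0; rewrite inE ys orbT.
set d := `|w - z| ^+ 2; have d0 : 0 < d by rewrite exprn_gt0// normr_gt0 subr_eq0.
exists (A + `|w| ^+ 2 / d), (B - z / d); split.
- by rewrite addr_ge0// divr_ge0 ?exprn_ge0// ltW.
- by rewrite addr_ge0// -mulNr divr_ge0 ?oppr_ge0// ltW.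
rewrite big_cons derivM derivXsubC !hornerE/=.
rewrite mulrDr mulrCA AB.
have dE : d = (w - z) * (w^* - z).
  by rewrite /d normCK rmorphB/= (CrealP (ler0_real z0)).
have dn0 := lt0r_neq0 d0; rewrite normCK.
have := dn0; rewrite dE mulf_eq0 negb_or => /andP[h1 h2].
by field; rewrite h1 h2.
Qed.

(** At a root [w] of the combination that is not a root of [p], division by [p.[w]] gives
    [c + A + B w = 0]. As [c + A > 0], this forces [B > 0] and [w = - (c + A) / B]. *)
Lemma euler_deriv_npos p c : 0 < c -> p != 0 -> (forall z, root p z -> z <= 0) ->
  forall z, root (c *: p + 'X * p^`()) z -> z <= 0.
Proof.
move=> c0 p0 pnp w; have [s [ps rs]] := root_factors p0.
have [ws _|ws] := boolP (w \in s); first by apply: pnp; rewrite rs.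
have [|A [B [A0 B0 /= AB]]] := @log_deriv_npos s w _ ws.
  by move=> z; rewrite -rs; apply: pnp.
have pw : p.[w] != 0 by rewrite -rootE rs.
have pAB : w * p^`().[w] = p.[w] * (A + B * w).
  by rewrite ps derivZ !hornerZ mulrCA AB mulrA.
rewrite rootE !hornerE pAB mulrC -mulrDr.
rewrite mulf_eq0 (negPf pw)/= => /eqP cAB.
rewrite addrA in cAB; have [B00|Bn0] := eqVneq B 0.
  by move: cAB; rewrite B00 mul0r addr0 => /eqP; rewrite gt_eqF// ltr_pwDl.
have -> : w = - ((c + A) / B).
  by apply: (mulfI Bn0); rewrite mulrN mulrCA mulfV// mulr1; apply/eqP; rewrite -addr_eq0 addrC cAB.
by rewrite oppr_le0 divr_ge0// addr_ge0// ltW.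
Qed.

(** Adjoining a root [z] turns the defect [q'^2 - q q''] into [(x - z)^2] times itself plus [q^2],
    so it stays nonnegative. *)
Lemma laguerre_prod s x : {in s, forall z, z \is Num.real} -> x \is Num.real ->
  let q := \prod_(z <- s) ('X - z%:P) in
  q.[x] \is Num.real /\ q.[x] * q^`()^`().[x] <= q^`().[x] ^+ 2.
Proof.
move=> + xr; elim: s => [|z s IHs] sr /=.
  by rewrite big_nil -polyC1 !derivC !hornerE ?mulr0 ?expr0n; split=> //;
    rewrite ?realE ?ler01 ?mulr0 ?expr0n.
have zr : z \is Num.real by apply: sr; rewrite mem_head.
have {IHs} [|qr Lq] := IHs.
  by move=> y ys; apply: sr; rewrite inE ys orbT.
rewrite big_cons; set q := \prod_(z <- s) _ in qr Lq *.
rewrite derivM derivXsubC mul1r derivD derivM derivXsubC mul1r.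
rewrite !(hornerXsubC, hornerD, hornerM); split.
  by rewrite realM// realB.
rewrite -subr_ge0 [leRHS](_ : _ = (x - z) ^+ 2 *
  (q^`().[x] ^+ 2 - q.[x] * q^`()^`().[x]) + q.[x] ^+ 2); last by ring.
apply: addr_ge0; last by rewrite real_exprn_even_ge0.
by rewrite mulr_ge0 ?subr_ge0// real_exprn_even_ge0// realB.
Qed.

Lemma laguerre p x : lead_coef p \is Num.real -> (forall z, root p z -> z \is Num.real) ->
  x \is Num.real -> p.[x] * p^`()^`().[x] <= p^`().[x] ^+ 2.
Proof.
move=> lr pr xr; have [->|p0] := eqVneq p 0.
  by rewrite -polyC0 !derivC !hornerE ?mulr0 expr0n.
have [s [ps rs]] := root_factors p0; rewrite ps.
have [|_] := @laguerre_prod s x _ xr; first by move=> z; rewrite -rs; apply: pr.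
rewrite !(derivZ, hornerZ) /=; set q := \prod_(z <- s) _ => Lq.
rewrite exprMn mulrACA -expr2 ler_wpM2l// real_exprn_even_ge0//.
Qed.

(* A polynomial [g] of degree [m] without roots within [d] of [z0] satisfies
   [|g(z0)| >= |lead g| d^m]. *)
Lemma root_continuity (m : nat) p z0 d : size p = m.+1 -> root p z0 -> 0 < d ->
  exists2 e, 0 < e & forall g : {poly C}, (size g <= m.+1)%N ->
    (forall k, (k <= m)%N -> `|g`_k - p`_k| <= e) ->
    exists2 z, root g z & `|z - z0| < d.
Proof.
move=> sp rp d0; set S := \sum_(k < m.+1) `|z0| ^+ k.
have S0 : 0 <= S by apply: sumr_ge0 => k _; apply: exprn_ge0.
have pm : p`_m != 0.
  by have := lead_coef_eq0 p; rewrite lead_coefE sp/= -size_poly_eq0 sp => ->.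
set a := `|p`_m| / 2; have a0 : 0 < a by rewrite divr_gt0// normr_gt0.
set b := a * d ^+ m; have b0 : 0 < b by rewrite mulr_gt0// exprn_gt0.
have S1 : 0 < S + 1 by rewrite ltr_wpDl.
have bS0 : 0 < b / (S + 1) by rewrite divr_gt0.
have ab0 : 0 < a + b / (S + 1) by rewrite addr_gt0.
(* A common lower bound of [a] and [b / (S + 1)]: the first keeps the leading coefficient of [g] at
   least [a] in modulus, the second gives [|g(z0)| <= e * S < b]. *)
set e := a * (b / (S + 1)) / (a + b / (S + 1)).
exists e; first by rewrite divr_gt0// mulr_gt0.
move=> g sg gp.
have ea : e <= a.
  by rewrite /e ler_pdivrMr// ler_pM2l// lerDr ltW.
have eb : e <= b / (S + 1).
  by rewrite /e ler_pdivrMr// mulrC ler_pM2l// lerDl ltW.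
have agm : a <= `|g`_m|.
  have /(le_trans)/(_ ea) := gp m (leqnn m).
  have : `|p`_m| <= `|g`_m| + `|g`_m - p`_m|.
    by rewrite -{1}[p`_m](subKr g`_m) (le_trans (ler_normB _ _)).
  move=> h1 h2; have := le_trans h1 (lerD (lexx _) h2).
  by rewrite /a {1}[`|p`_m|]splitr lerD2r.
have gm : g`_m != 0 by rewrite -normr_gt0 (lt_le_trans a0).
have sg' : size g = m.+1.
  by apply/eqP; rewrite eqn_leq sg ltnNge; apply: contra gm => /leq_sizeP/(_ m (leqnn m)) ->.
have g0 : g != 0 by rewrite -size_poly_eq0 sg'.
have [s [gs rs]] := root_factors g0.
have ss : size s = m.
  have : size g = (size s).+1 by rewrite gs size_scale ?lead_coef_eq0// size_prod_XsubC.
  by rewrite sg' => -[].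
have lg : lead_coef g = g`_m by rewrite lead_coefE sg'.
have gz : `|g.[z0]| <= e * S.
  rewrite -[g.[z0]]subr0 -(rootP rp) -hornerN -hornerD (@horner_coef_wide _ m.+1); last first.
    by rewrite (leq_trans (size_polyD _ _))// geq_max sg size_polyN sp leqnn.
  rewrite (le_trans (ler_norm_sum _ _ _))// mulr_sumr; apply: ler_sum => k _.
  by rewrite coefB normrM normrX ler_wpM2r ?exprn_ge0// gp// -ltnS.
have [/hasP[z zs zd]|/hasPn far] := boolP (has (fun z => `|z - z0| < d) s).
  by exists z => //; rewrite rs.
have : b <= `|g.[z0]|.
  rewrite gs hornerZ normrM lg horner_prod normr_prod.
  apply: ler_pM; rewrite ?exprn_ge0 ?(ltW a0) ?(ltW d0)//.
  have : {in s, forall z, d <= `|z - z0|}.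
    by move=> z zs; rewrite real_leNgt ?far// ger0_real// ltW.
  rewrite -ss; elim: (s) => [|z t IHt] tfar; first by rewrite big_nil expr0.
  rewrite /= exprS big_cons ler_pM ?exprn_ge0 ?(ltW d0)//.
    by rewrite hornerXsubC distrC tfar ?mem_head.
  by apply: IHt => y yt; apply: tfar; rewrite inE yt orbT.
move=> /le_trans/(_ gz) /le_trans/(_ (ler_wpM2r S0 eb)).
rewrite mulrAC ler_pdivlMr// ler_pM2l// -[leRHS]addr0 lerD2l => /le_lt_trans/(_ ltr01).
by rewrite ltxx.
Qed.

End complex_roots.

(** * Even parts of polynomials without roots in the open right half plane *)

Section hermite_biehler.
Variable C : numClosedFieldType.
Implicit Types (p : {poly C}) (s : seq C) (w x z : C).

Lemma normC2_reflection w z :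
  `|w - z| ^+ 2 = `|- w^* - z| ^+ 2 - 4 * ('Re w * 'Re z).
Proof.
rewrite !normC2_Re_Im !raddfB !raddfN /= Re_conj Im_conj; ring.
Qed.

(** The mirror image [- w^*] of [w] in the imaginary axis lies on the side of [z]; the squared
    distances differ by [4 |Re w Re z|], which vanishes only for [z] on the axis. *)
Lemma ler_norm_reflection w z : 0 < 'Re w -> 'Re z <= 0 ->
  `|- w^* - z| <= `|w - z| ?= iff ('Re z == 0).
Proof.
move=> w0 z0; apply/leifP; case: eqVneq => [zz|zn0].
  by rewrite -(@eqrXn2 _ 2)// (normC2_reflection w) zz !mulr0 subr0.
rewrite -ltr_sqr ?nnegrE// (normC2_reflection w) ltrDl oppr_gt0.
by rewrite pmulr_rlt0// pmulr_rlt0// lt_neqAle zn0.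
Qed.

Lemma ler_norm_prod_reflection s w : 0 < 'Re w -> {in s, forall z, 'Re z <= 0} ->
  `|\prod_(z <- s) (- w^* - z)| <= `|\prod_(z <- s) (w - z)|
  ?= iff all (fun z => 'Re z == 0) s.
Proof.
move=> w0; elim: s => [|z s IHs] sr; first by rewrite !big_nil; apply/leif_refl.
rewrite !big_cons !normrM /=.
have zr := ler_norm_reflection w0 (sr z (mem_head _ _)).
have {}IHs : `|\prod_(z <- s) (- w^* - z)| <= `|\prod_(z <- s) (w - z)|
  ?= iff all (fun z => 'Re z == 0) s.
  by apply: IHs => y ys; apply: sr; rewrite inE ys orbT.
have := leif_pM (normr_ge0 _) (normr_ge0 _) zr IHs; rewrite -!normrM normr_eq0.
suff /negPf -> : (w - z) * \prod_(z <- s) (w - z) != 0 by [].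
suff wn t : t \in z :: s -> w - t != 0.
  rewrite mulf_neq0 ?wn ?mem_head//; rewrite prodf_seq_neq0.
  by apply/allP => t ts /=; rewrite wn// inE ts orbT.
move=> /sr tr; rewrite subr_eq0; apply: contraTneq w0 => ->.
by rewrite -real_leNgt ?Creal_Re.
Qed.

Lemma hermite_biehler_even p : (1 < size p)%N ->
  (forall k, (k < size p)%N -> 0 < p`_k) ->
  (forall z, root p z -> 'Re z <= 0) ->
  forall z, root (even_poly p) z -> z <= 0.
Proof.
move=> sp ppos pRe z rz.
have p0 : p != 0 by rewrite -size_poly_gt0 (ltn_trans _ sp).
have [s [ps rs]] := root_factors p0.
have sRe : {in s, forall z, 'Re z <= 0} by move=> y; rewrite -rs; apply: pRe.
have pE x : p.[x] = lead_coef p * \prod_(z <- s) (x - z).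
  rewrite {1}ps hornerZ horner_prod; congr (_ * _).
  by apply: eq_bigr => y _; rewrite hornerXsubC.
have pconj x : p.[x^*] = p.[x]^*.
  rewrite -horner_map; congr (_.[_]); apply/polyP => k; rewrite coef_map /=.
  have [kp|kp] := ltnP k (size p); last by rewrite nth_default// rmorph0.
  by rewrite (CrealP _)// gtr0_real// ppos.
have [//|zn0] := boolP (z <= 0).
(* A purely imaginary square root would give [z = - y^2 <= 0]; otherwise one of the two roots lies
   in the open right half plane. *)
have [w [wz w0]] : exists w, w ^+ 2 = z /\ 0 < 'Re w.
  have := sqrtCK z; set w := sqrtC z => wz.
  have Rw : 'Re w \is Num.real := Creal_Re w.
  have [w0|w0|w0] := real_ltgtP Rw (@real0 C).
  - by exists (- w); rewrite sqrrN raddfN/= oppr_gt0.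
  - by exists w.
  - case/negP: zn0; rewrite -wz (Crect w) w0 add0r exprMn sqrCi mulN1r oppr_le0.
    by rewrite real_exprn_even_ge0// Creal_Im.
have : p.[w] + p.[- w] = 0.
  rewrite -{1 2}(poly_even_odd p) !(hornerXn, hornerX, horner_comp, hornerD, hornerM).
  by rewrite sqrrN wz (rootP rz); ring.
move=> /eqP; rewrite addr_eq0 => /eqP /(congr1 (fun x => `|x|)).
rewrite normrN -[in RHS]norm_conjC -pconj rmorphN /= !pE !normrM.
have ln0 : `|lead_coef p| != 0 by rewrite normr_eq0 lead_coef_eq0.
move=> /(mulfI ln0) eqw.
have := ler_norm_prod_reflection w0 sRe => -[_]; rewrite -eqw eqxx => /esym s0.
(* With all roots on the axis, reflecting the point 1 gives [|p(-1)| = |p(1)|]; but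
   [|p_0 - p_1| < p_0 + p_1] makes the left side strictly smaller. *)
have R1 : 0 < 'Re (1 : C) by rewrite (Creal_ReP 1 _)// real1.
have := ler_norm_prod_reflection R1 sRe => -[_]; rewrite s0 => /eqP.
move=> /(congr1 (fun x => `|lead_coef p| * x)); rewrite rmorph1 -!normrM -!pE.
case: (size p) (sp) (ppos) (@horner_coef _ p) => [|[|n]]// _ pp hp; rewrite !hp.
rewrite !big_ord_recl /= !expr0 !expr1 !mulr1 => /eqP; rewrite lt_eqF//.
have p0' := pp 0%N isT; have p1' := pp 1%N isT.
set S1 := \sum_(i < n) _; set S2 := \sum_(i < n) _.
have S12 : `|S1| <= S2.
  rewrite (le_trans (ler_norm_sum _ _ _))//; apply: ler_sum => i _.
  have /pp/ltW h : (bump 0 (bump 0 i) < n.+2)%N by have := ltn_ord i; rewrite /bump; lia.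
  by rewrite expr1n mulr1 normrM normrX normrN1 expr1n mulr1 ger0_norm.
have S20 : 0 <= S2 by rewrite (le_trans _ S12).
rewrite [ltRHS]ger0_norm ?addr_ge0 ?(ltW p0') ?(ltW p1')//.
rewrite addrA (le_lt_trans (ler_normD _ _))// addrA ltr_leD// mulrN1.
rewrite real_ltr_norml ?realB ?gtr0_real//; apply/andP; split.
  by rewrite opprD ltrD2r gt0_cp.
by rewrite ltrD2l gt0_cp.
Qed.

End hermite_biehler.

(** * The limit polynomial violates Laguerre's inequality *)

Section gamma_ratio.
Variable R : realFieldType.

Definition gamma_ratio (r j : nat) : R := \prod_(i < j) ((2 * i.+1)%:R / (2 * i.+1 + r)%:R).

Lemma gamma_ratio0 r : gamma_ratio r 0 = 1. Proof. by rewrite /gamma_ratio big_ord0. Qed.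

Lemma gamma_ratioS r j : gamma_ratio r j.+1 = gamma_ratio r j * ((2 * j.+1)%:R / (2 * j.+1 + r)%:R).
Proof. by rewrite /gamma_ratio big_ord_recr. Qed.

Lemma gamma_ratio_gt0 r j : 0 < gamma_ratio r j.
Proof. by apply: prodr_gt0 => i _; rewrite divr_gt0// ltr0n; lia. Qed.

Lemma gamma_ratio_shift r j :
  gamma_ratio r j = ((2 * j + r + 2)%:R / (r + 2)%:R) * gamma_ratio (r + 2) j.
Proof.
elim: j => [|j IHj]; first by rewrite !gamma_ratio0 mulr1 muln0 add0n divff// pnatr_eq0; lia.
rewrite !gamma_ratioS IHj.
have e1 : (2 * j.+1 + r = 2 * j + r + 2)%N by lia.
rewrite e1 (_ : 2 * j + r + 2 + 2 = 2 * j.+1 + (r + 2))%N; last by lia.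
have B0 : (2 * j + r + 2)%:R != 0 :> R by rewrite pnatr_eq0; lia.
have D0 : (2 * j.+1 + (r + 2))%:R != 0 :> R by rewrite pnatr_eq0; lia.
have E0 : (r + 2)%:R != 0 :> R by rewrite pnatr_eq0; lia.
move: B0 D0 E0; move: (_ %:R) (_ %:R) (_ %:R) => B D E E0 D0 B0.
by field; rewrite B0 D0 E0.
Qed.

(* The polynomial G_(n,r). *)
Definition disk_even (r n : nat) : {poly R} :=
  \poly_(j < n.+1) ('C(n, 2 * j)%:R * gamma_ratio r j).

Lemma disk_even_coef r n j : (disk_even r n)`_j = 'C(n, 2 * j)%:R * gamma_ratio r j.
Proof.
rewrite coef_poly; case: ltnP => // nj.
by rewrite bin_small ?mul0r//; lia.
Qed.

Lemma disk_even_neq0 r n : disk_even r n != 0.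
Proof.
apply/eqP => /(congr1 (fun p : {poly R} => p`_0)); rewrite disk_even_coef coef0.
by rewrite muln0 bin0 mul1r gamma_ratio0 => /eqP; rewrite oner_eq0.
Qed.

(** On coefficients, [1 + (2/(r+2)) z d/dz] multiplies by [(2j + r + 2)/(r + 2)], the factor in
    [gamma_ratio_shift]. The outer scalar is pulled out to match [euler_deriv_npos]. *)
Lemma disk_even_shift r n :
  disk_even r n = (2 / (r + 2)%:R) *: (((r + 2)%:R / 2) *: disk_even (r + 2) n
                             + 'X * (disk_even (r + 2) n)^`()).
Proof.
apply/polyP => j; rewrite coefZ coefD coefZ mulrC.
rewrite coefXM coef_deriv.
have r0 : (r + 2)%:R != 0 :> R by rewrite pnatr_eq0; lia.
have r0' : r%:R + 2 != 0 :> R by rewrite -(natrD _ r 2).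
rewrite !disk_even_coef (gamma_ratio_shift r) -mulr_natr.
case: j => [|j] /=; first by rewrite addr0; field.
by rewrite -addn1 !natrD !natrM; field.
Qed.

(* The terms of the limit of [disk_even r n] at [-256/n^2] are [(-1)^j * lterm r j]. *)
Definition lterm (r j : nat) : R := gamma_ratio r j * 256 ^+ j / (2 * j)`!%:R.

Lemma lterm0 r : lterm r 0 = 1.
Proof. by rewrite /lterm gamma_ratio0 mul1r divr1. Qed.

Lemma lterm_gt0 r j : 0 < lterm r j.
Proof. by rewrite divr_gt0 ?mulr_gt0 ?gamma_ratio_gt0 ?exprn_gt0// ltr0n fact_gt0. Qed.

Lemma ltermS r j : lterm r j.+1 =
  lterm r j * (256 / ((2 * j + 2 + r)%:R * (2 * j + 1)%:R)).
Proof.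
rewrite /lterm gamma_ratioS exprS (_ : 2 * j.+1 = (2 * j).+2)%N; last by lia.
rewrite !factS !natrM.
have f0 : (2 * j)`!%:R != 0 :> R by rewrite pnatr_eq0 -lt0n fact_gt0.
rewrite (_ : (2 * j).+2 = 2 * j.+1)%N; last by lia.
rewrite (_ : (2 * j).+1 = 2 * j + 1)%N; last by lia.
rewrite (_ : 2 * j.+1 + r = 2 * j + 2 + r)%N; last by lia.
have A0 : (2 * j.+1)%:R != 0 :> R by rewrite pnatr_eq0; lia.
have B0 : (2 * j + 1)%:R != 0 :> R by rewrite pnatr_eq0; lia.
have D0 : (2 * j + 2 + r)%:R != 0 :> R by rewrite pnatr_eq0; lia.
move: A0 B0 D0 f0; move: (2 * j.+1)%:R (2 * j + 1)%:R (2 * j + 2 + r)%:R (_`!)%:R.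
by move=> A B D f A0 B0 D0 f0; field; rewrite A0 B0 D0 f0.
Qed.

(** Horner scheme for [d] terms of the alternating series from index [j] on, divided by
    [(-1)^j * lterm r j]. Only the ratios of [ltermS] occur, so no factorials or powers have to be
    evaluated. The falling factorial comes from the [i]-th derivative. *)
Fixpoint lhorner (r i j d : nat) : R :=
  if d is d'.+1 then
    (j ^_ i)%:R - 256 / ((2 * j + 2 + r)%:R * (2 * j + 1)%:R) * lhorner r i j.+1 d'
  else 0.

Lemma lhornerE r i d : \sum_(j < d) (j ^_ i)%:R * (-1) ^+ j * lterm r j = lhorner r i 0 d.
Proof.
suff H k : \sum_(j < d) ((k + j) ^_ i)%:R * (-1) ^+ j * lterm r (k + j)
    = lterm r k * lhorner r i k d.
  by rewrite -[RHS]mul1r -[in RHS](lterm0 r) -H.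
elim: d k => [|d IHd] k; first by rewrite big_ord0 mulr0.
rewrite big_ord_recl /= addn0 mulr1 mulrBr (mulrA (lterm r k)) -ltermS -IHd [in LHS]mulrC.
congr (_ + _).
rewrite -sumrN; apply: eq_bigr => j _; rewrite /bump /= add1n addSnnS exprS; ring.
Qed.

(** For [m = 2 * j], the factor by which the [j]-th term of [disk_even r n] at [-256/n^2] differs
    from its limit. *)
Definition ffrac (n m : nat) : R := (n ^_ m)%:R / n%:R ^+ m.

(** Each new factor [(n - m)/n] lowers the value by at most [m/n], and [m^2 + m <= (m + 1)^2]. *)
Lemma ffrac_bounds n m : (0 < n)%N ->
  1 - (m ^ 2)%:R / n%:R <= ffrac n m <= 1.
Proof.
move=> n0; have n0' : 0 < n%:R :> R by rewrite ltr0n.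
elim: m => [|m /andP[IH1 IH2]].
  by rewrite /ffrac ffactn0 expr0 divr1 mul0r subr0 !lexx.
have eS : ffrac n m.+1 = ffrac n m * ((n - m)%:R / n%:R).
  rewrite /ffrac ffactnSr natrM exprSr; field.
  by rewrite expf_neq0 ?gt_eqF.
have f0 : 0 <= ffrac n m by rewrite divr_ge0 ?exprn_ge0.
have h2 : (n - m)%:R / n%:R <= 1 :> R.
  by rewrite ler_pdivrMr// mul1r ler_nat leq_subr.
have h1 : 1 - m%:R / n%:R <= (n - m)%:R / n%:R :> R.
  rewrite ler_pdivlMr// mulrBl mul1r divfK ?gt_eqF// lerBlDr -natrD ler_nat; lia.
rewrite eS; apply/andP; split; last first.
  by rewrite -[leRHS]mul1r ler_pM// divr_ge0.
have h3 : ffrac n m - m%:R / n%:R <= ffrac n m * ((n - m)%:R / n%:R).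
  apply: le_trans (ler_wpM2l f0 h1); rewrite mulrBr mulr1 lerD2l lerN2.
  by rewrite -[leRHS]mul1r ler_wpM2r// divr_ge0.
apply: le_trans h3; apply: le_trans (lerB IH1 (lexx _)).
rewrite -addrA -opprD lerD2l lerN2 -mulrDl -natrD ler_wpM2r ?invr_ge0 ?(ltW n0')// ler_nat; lia.
Qed.

(** From index 36 on the terms at least halve, so the tail is at most twice its first term, where
    [1296 = 36^2]. The weight [j^2] dominates the falling factorials [j ^_ i] for [i <= 2]. *)
Lemma lterm_tail r (m : nat) : (36 <= m)%N ->
  \sum_(36 <= j < m) (j ^ 2)%:R * lterm r j <= 2 * (1296 * lterm r 36).
Proof.
move=> m36; pose v j : R := (j ^ 2)%:R * lterm r j.
have v0 j : 0 <= v j by rewrite mulr_ge0// ltW// lterm_gt0.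
have vS j : (36 <= j)%N -> v j.+1 <= v j / 2.
  move=> j36; rewrite /v ltermS mulrCA [leRHS]mulrAC [leRHS]mulrC.
  rewrite ler_wpM2l ?(ltW (lterm_gt0 _ _))//.
  rewrite mulrA ler_pdivrMr; last by rewrite -natrM ltr0n; lia.
  rewrite mulrAC ler_pdivlMr// -!natrM ler_nat.
  have : (j.+1 ^ 2 * 512 <= j ^ 2 * ((2 * j + 2) * (2 * j + 1)))%N.
    by nia.
  move=> h; rewrite -mulnA (leq_trans h)// leq_mul2l; apply/orP; right.
  by rewrite leq_mul2r; apply/orP; right; rewrite leq_addr.
(* Subtracting [2 * v m] makes the bound inductive. *)
suff : \sum_(36 <= j < m) v j <= 2 * v 36 - 2 * v m.
  move=> /le_trans; apply; rewrite /v lerBlDr lerDl.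
  by rewrite mulr_ge0// mulr_ge0// ltW// lterm_gt0.
elim: m m36 => // m IHm; rewrite leq_eqVlt => /predU1P[<-|m36].
  by rewrite big_geq// subrr.
rewrite big_nat_recr//= (le_trans (lerD (IHm _) (lexx _)))//.
have := vS m m36; set a := v m; set b := v m.+1; set c := v 36%N; lra.
Qed.

End gamma_ratio.

(** * Numerical failure of Laguerre's inequality for large n *)

Section base.
Variable R : realType.

Definition scaled_deriv (r i n : nat) : R :=
  \sum_(j < n.+1) (j ^_ i)%:R * (ffrac R n (2 * j) * (-1) ^+ j * lterm R r j).

(** By [ffrac_bounds] the first 36 terms are off their limits by at most [K / n] in total; the
    others are bounded uniformly in [n] by [lterm_tail], as [ffrac] is at most 1. *)
Lemma scaled_deriv_approx r i (d : R) : (i <= 2)%N -> 0 < d -> exists N, forall n,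
  (N <= n)%N -> `|scaled_deriv r i n - lhorner R r i 0 36| <= d + 2 * (1296 * lterm R r 36).
Proof.
move=> i2 d0; pose K : R := \sum_(j < 36) (j ^_ i)%:R * lterm R r j * ((2 * j) ^ 2)%:R.
have lt0 j : 0 <= lterm R r j by rewrite ltW// lterm_gt0.
have K0 : 0 <= K by apply: sumr_ge0 => j _; rewrite mulr_ge0// mulr_ge0.
exists (maxn 36 (Num.bound (K / d))) => n; rewrite geq_max => /andP[n36 nK].
have n0 : (0 < n)%N by rewrite (leq_trans _ n36).
have n0' : 0 < n%:R :> R by rewrite ltr0n.
have Kn : K / n%:R <= d.
  rewrite ler_pdivrMr// mulrC -ler_pdivrMr// ltW//.
  have Kd0 : 0 <= K / d by rewrite divr_ge0// ltW.
  by apply: lt_le_trans (archi_boundP Kd0) _; rewrite ler_nat.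
have fb m := @ffrac_bounds R n m n0.
rewrite /scaled_deriv -(big_mkord predT
  (fun j => (j ^_ i)%:R * (ffrac R n (2 * j) * (-1) ^+ j * lterm R r j))).
rewrite (@big_cat_nat _ _ _ 36)//; last by rewrite (leq_trans n36).
rewrite big_mkord -lhornerE addrAC -sumrB.
apply: le_trans (ler_normD _ _) _; apply: lerD.
  apply: le_trans Kn; rewrite mulr_suml; apply: le_trans (ler_norm_sum _ _ _) _.
  apply: ler_sum => j _.
  rewrite (_ : _ - _ = (-1) ^+ j *
    ((j ^_ i)%:R * lterm R r j * (ffrac R n (2 * j) - 1))); last by ring.
  rewrite normrM normrX normrN1 expr1n mul1r normrM -[leRHS]mulrA.
  have c0 : 0 <= (j ^_ i)%:R * lterm R r j by apply: mulr_ge0.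
  rewrite (ger0_norm c0) ler_wpM2l// distrC; have /andP[f1 f2] := fb (2 * j)%N.
  by rewrite ger0_norm ?subr_ge0// lerBlDr addrC -lerBlDr.
apply: le_trans (lterm_tail R r (leq_trans n36 (leqnSn n))).
apply: le_trans (ler_norm_sum _ _ _) _; apply: ler_sum_nat => j /andP[j36 _].
have /andP[f1 f2] := fb (2 * j)%N.
have f0 : 0 <= ffrac R n (2 * j) by rewrite divr_ge0 ?exprn_ge0// ltW.
have l0 := lt0 j; move: (ffrac _ _ _) (lterm _ _ _) f0 f2 l0 => f l f0 f2 l0 {f1}.
rewrite !normrM normrX normrN1 expr1n mulr1 normr_nat !ger0_norm//.
apply: ler_pM => //; first by rewrite mulr_ge0.
  rewrite ler_nat; clear -i2 j36; case: i i2 => [|[|[|]]]// _;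
    rewrite ?ffactn0 ?ffactn1 //; try nia.
  by rewrite ffactnSr ffactn1; nia.
by rewrite -[leRHS]mul1r ler_wpM2r.
Qed.

Lemma disk_even_term (r n j : nat) : (0 < n)%N ->
  'C(n, 2 * j)%:R * gamma_ratio R r j * (- 256 / n%:R ^+ 2) ^+ j =
  ffrac R n (2 * j) * (-1) ^+ j * lterm R r j.
Proof.
move=> n0; rewrite /ffrac /lterm -bin_ffact natrM.
rewrite mulNr -mulN1r exprMn expr_div_n -exprM.
have f0 : (2 * j)`!%:R != 0 :> R by rewrite pnatr_eq0 -lt0n fact_gt0.
have n0' : n%:R ^+ (2 * j) != 0 :> R by rewrite expf_neq0// pnatr_eq0 -lt0n.
by field; rewrite f0 n0'.
Qed.

Lemma scaled_derivE (r n : nat) : (0 < n)%N ->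
  let p := disk_even R r n in let x := - 256 / n%:R ^+ 2 in
  [/\ p.[x] = scaled_deriv r 0 n, x * p^`().[x] = scaled_deriv r 1 n &
      x ^+ 2 * p^`()^`().[x] = scaled_deriv r 2 n].
Proof.
move=> n0 /=; set x := (_ / _ : R); rewrite /disk_even poly_def.
split.
- rewrite horner_sum; apply: eq_bigr => j _.
  by rewrite hornerZ hornerXn disk_even_term// ffactn0 mul1r.
- rewrite raddf_sum horner_sum mulr_sumr; apply: eq_bigr => j _.
  rewrite /= derivZ hornerZ derivXn hornerMn hornerXn -disk_even_term// -/x ffactn1.
  by case: (nat_of_ord j) => [|k]; rewrite ?mul0r ?mulr0// exprS; ring.
- rewrite !raddf_sum horner_sum mulr_sumr; apply: eq_bigr => j _.
  rewrite /= !derivZ hornerZ derivXn derivMn derivXn !hornerMn hornerXn -disk_even_term// -/x.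
  rewrite -mulrnA; case: (nat_of_ord j) => [|[|k]];
    rewrite ?muln0 ?mul0n ?ffactn0 ?ffactSS ?ffactn1 ?mul0r ?mulr0//.
  by rewrite ffactn0 /= !exprS; ring.
Qed.

(** Multiplied by [x^2], Laguerre's inequality involves only the scaled derivatives at
    [x = -256/n^2]. Each is within [d] of its truncated series: [d/2] for the head, by taking [n]
    large, and [d/2] for the tail. Those of order 0 and 2 are both negative, and [gap] keeps their
    product above the square of the first. *)
Lemma laguerre_fails (r : nat) (a0 a1 a2 d : R) : 0 < d -> d < a0 -> d < a2 ->
  (a1 + d) ^+ 2 < (a0 - d) * (a2 - d) ->
  lhorner R r 0 0 36 <= - a0 -> `|lhorner R r 1 0 36| <= a1 -> lhorner R r 2 0 36 <= - a2 ->
  2 * (1296 * lterm R r 36) <= d / 2 ->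
  exists N, forall n, (N <= n)%N -> exists x,
    let p := disk_even R r n in p^`().[x] ^+ 2 < p.[x] * p^`()^`().[x].
Proof.
move=> d0 da0 da2 gap h0 h1 h2 ht.
have d2 : 0 < d / 2 by rewrite divr_gt0.
have [N0 A0] := @scaled_deriv_approx r 0 _ isT d2.
have [N1 A1] := @scaled_deriv_approx r 1 _ isT d2.
have [N2 A2] := @scaled_deriv_approx r 2 _ isT d2.
exists (maxn (maxn N0 N1) (maxn N2 1)) => n; rewrite !geq_max => /and3P[/andP[n0 n1] n2 n3].
have [e0 e1 e2] := scaled_derivE r n3.
set x := - 256 / n%:R ^+ 2 in e0 e1 e2.
have x0 : x != 0.
  by rewrite mulf_neq0 ?invr_eq0 ?expf_neq0 ?pnatr_eq0 -?lt0n// oppr_eq0 pnatr_eq0.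
exists x => /=; have x2 : 0 < x ^+ 2 by rewrite exprn_even_gt0.
rewrite -(ltr_pM2l x2) -exprMn e1 mulrCA e2 e0.
have close i : `|scaled_deriv r i n - lhorner R r i 0 36| <= d / 2 + 2 * (1296 * lterm R r 36) ->
    `|scaled_deriv r i n - lhorner R r i 0 36| <= d.
  by move=> /le_trans; apply; rewrite [leRHS]splitr lerD2l.
have := close _ (A0 _ n0); have := close _ (A1 _ n1); have := close _ (A2 _ n2).
move: h0 h1 h2; rewrite !ler_norml.
move: (scaled_deriv r 0 n) (scaled_deriv r 1 n) (scaled_deriv r 2 n) => s0 s1 s2.
move: (lhorner R r 0 0 36) (lhorner R r 1 0 36) (lhorner R r 2 0 36) => l0 l1 l2.
move=> h0 /andP[h1 h1'] h2 /andP[c2 c2'] /andP[c1 c1'] /andP[c0 c0'].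
clear -d0 da0 da2 gap h0 h1 h1' h2 c2 c2' c1 c1' c0 c0'.
have h3 : s1 ^+ 2 <= (a1 + d) ^+ 2.
  rewrite -subr_ge0 subr_sqr; clear gap; apply: mulr_ge0; lra.
have h4 : (a0 - d) * (a2 - d) <= s0 * s2.
  rewrite -[leRHS]mulrNN; clear gap; apply: ler_pM; lra.
by rewrite (le_lt_trans h3)// (lt_le_trans gap).
Qed.

(* [lra] needs the natural-number subterms evaluated to numerals. *)
Ltac eval_nat := repeat match goal with |- context [ (?n)%:R ] =>
  lazymatch n with
  | context [addn] => let m := eval vm_compute in n in change n with m
  | context [falling_factorial] => let m := eval vm_compute in n in change n with m
  end end.

(* For r = 5 the three sums are about -0.00216, 0.0299 and -1.204; for r = 6
   they are about -0.0172, 0.0874 and -0.729. *)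
Lemma laguerre_fails5 : exists N, forall n, (N <= n)%N -> exists x,
    let p := disk_even R 5 n in p^`().[x] ^+ 2 < p.[x] * p^`()^`().[x].
Proof.
apply: (@laguerre_fails 5 (2 / 1000) (31 / 1000) (12 / 10) (10 ^- 5)).
1-4: lra.
1,3: by rewrite /lhorner; eval_nat; lra.
  by rewrite ler_norml; apply/andP; split; rewrite /lhorner; eval_nat; lra.
by rewrite !ltermS lterm0; eval_nat; lra.
Qed.

Lemma laguerre_fails6 : exists N, forall n, (N <= n)%N -> exists x,
    let p := disk_even R 6 n in p^`().[x] ^+ 2 < p.[x] * p^`()^`().[x].
Proof.
apply: (@laguerre_fails 6 (17 / 1000) (88 / 1000) (72 / 100) (10 ^- 5)).
1-4: lra.
1,3: by rewrite /lhorner; eval_nat; lra.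
  by rewrite ler_norml; apply/andP; split; rewrite /lhorner; eval_nat; lra.
by rewrite !ltermS lterm0; eval_nat; lra.
Qed.

End base.

(** * Reduction of r to 5 or 6 *)

Section core.
Variable R : realType.

Local Notation toC := (map_poly (real_complex R)).

Lemma disk_even_root (r : nat) : (5 <= r)%N -> exists N, forall n, (N <= n)%N ->
  exists2 z : R[i], root (toC (disk_even R r n)) z & ~~ (z <= 0).
Proof.
(* [s] is the parity of [r - 5] and [k] counts shifts by 2, which all keep the same [N]:
   nonpositivity of all roots would pass from [r + 2] down to [r]. *)
suff H s : (s <= 1)%N -> forall k, exists N, forall n, (N <= n)%N ->
    ~ forall z : R[i], root (toC (disk_even R (5 + s + 2 * k) n)) z -> z <= 0.
  move=> r5; have [|N HN] := H (odd (r - 5)) _ (r - 5)./2.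
    by case: odd.
  exists N => n /HN; rewrite (_ : (5 + _ + _)%N = r) => [nP|]; last first.
    rewrite mul2n -addnA odd_double_half; lia.
  have p0 : toC (disk_even R r n) != 0 by rewrite map_poly_eq0 disk_even_neq0.
  have [s [_ rs]] := root_factors p0.
  have [/allP sP|/allPn[z zs z0]] := boolP (all (fun z => z <= 0) s).
    by case: nP => z; rewrite rs; apply: sP.
  by exists z => //; rewrite rs.
move=> s1; elim=> [|k [N HN]]; last first.
  exists N => n /HN nP h; apply: nP => z; rewrite disk_even_shift.
  set r' := (5 + s + 2 * k)%N; rewrite (_ : (5 + s + 2 * k.+1 = r' + 2)%N) in h; last first.
    by rewrite /r'; lia.
  rewrite map_polyZ rootZ ?fmorph_eq0; last first.
    by rewrite mulf_neq0 ?invr_eq0 ?pnatr_eq0//; lia.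
  rewrite rmorphD /= map_polyZ (rmorphM _ 'X) /= map_polyX -deriv_map.
  apply: euler_deriv_npos => //.
  - by rewrite ltcR divr_gt0// ltr0n; lia.
  - by rewrite map_poly_eq0 disk_even_neq0.
rewrite muln0 addn0.
have [N HN] : exists N, forall n, (N <= n)%N -> exists x,
    let p := disk_even R (5 + s) n in p^`().[x] ^+ 2 < p.[x] * p^`()^`().[x].
  case: s s1 => [|[|]]// _; [exact: laguerre_fails5|exact: laguerre_fails6].
exists N => n /HN[x /=] + h; rewrite ltNge => /negP; apply.
have xr : x%:C%C \is Num.real by rewrite complex_real.
have := @laguerre _ (toC (disk_even R (5 + s) n)) x%:C%C _ _ xr.
rewrite !deriv_map !horner_map -rmorphM -rmorphXn lecR; apply.
  by rewrite lead_coef_map complex_real.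
by move=> z /h /ler0_real.
Qed.

End core.

(** * Lebesgue integrals on tuples *)

Import HBNNSimple.

Section monotone.
Local Open Scope ereal_scope.

(* No measurability: the integral of a nonnegative function is a supremum over
   the simple functions below it. *)
Lemma ge0_le_integralT d (T : measurableType d) (R : realType)
    (mu : {measure set T -> \bar R}) (f g : T -> \bar R) :
  (forall x, 0 <= f x) -> (forall x, f x <= g x) ->
  \int[mu]_x f x <= \int[mu]_x g x.
Proof.
move=> f0 fg; have g0 x : 0 <= g x by rewrite (le_trans (f0 x)).
rewrite !ge0_integralTE//=; apply: ereal_sup_le => _ [h /= hf <-].
by exists h => // x; rewrite (le_trans (hf x)).
Qed.

Context {R : realType}.
Local Notation RT := (measurableTypeR R).

(** Arbitrary sets are allowed because the parallel bodies of the ellipsoid enter without a proof of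
    measurability. *)
Lemma le_lebesgue_tuple m (A B : set (m.-tuple RT)) : A `<=` B ->
  lebesgue_tuple m A <= lebesgue_tuple m B.
Proof.
elim: m A B => [|m IHm] A B AB.
  rewrite /= !diracE lee_fin ler_nat.
  by have [/set_mem/AB/mem_set ->|_] := boolP (_ \in A).
rewrite /= /lebesgue_cons /pushforward.
apply: ge0_le_integralT => x /=; first exact: measure_ge0.
by apply: IHm => t; rewrite /xsection /= !inE; apply: AB.
Qed.

Lemma le_volume m (A B : set 'rV[R]_m) : A `<=` B -> volume A <= volume B.
Proof. by move=> AB; apply: le_lebesgue_tuple => t /=; apply: AB. Qed.

Lemma integral_lebesgue_tupleS m (f : m.+1.-tuple RT -> \bar R) :
  measurable_fun [set: m.+1.-tuple RT] f -> (forall t, 0 <= f t) ->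
  \int[lebesgue_tuple m.+1]_t f t =
  \int[lebesgue_measure]_x \int[lebesgue_tuple m]_t f (cons_pair (x, t)).
Proof.
move=> mf f0; rewrite [LHS](@ge0_integral_pushforward _ _ _ _ _ _ (@measurable_cons_pair R m))//.
rewrite preimage_setT fubini_tonelli1//; last by move=> x; apply: f0.
exact: measurableT_comp mf (@measurable_cons_pair R m).
Qed.

Lemma integral_lebesgue_tuple0 (f : 0.-tuple RT -> \bar R) :
  measurable_fun [set: 0.-tuple RT] f -> \int[lebesgue_tuple 0]_t f t = f [tuple].
Proof. by move=> mf; rewrite /= integral_dirac// diracT mul1e. Qed.

End monotone.

(** * Wallis integrals *)

Section wallis.
Context {R : realType}.
Local Notation mu := (@lebesgue_measure R).

Definition halfdisk (k : nat) (x : R) : R := Num.sqrt (1 - x ^+ 2) ^+ k.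

(** With [x = sin u] this is the integral of [cos u ^+ k.+1] over [[-pi/2, pi/2]]. *)
Definition wallis (k : nat) : R := \int[mu]_(x in `[-1, 1]) halfdisk k x.

Lemma continuous_sqrtB (T : R) : continuous (fun x : R => Num.sqrt (T - x ^+ 2)).
Proof.
move=> x; apply: (@continuous_comp _ _ _ (fun x : R => T - x ^+ 2) Num.sqrt).
  by apply: cvgB; [exact: cvg_cst|exact: exprn_continuous].
exact: sqrt_continuous.
Qed.

Lemma continuous_halfdisk k : continuous (halfdisk k).
Proof.
move=> x; apply: (@continuous_comp _ _ _ (fun x : R => Num.sqrt (1 - x ^+ 2)) (fun y => y ^+ k)).
  exact: continuous_sqrtB.
exact: exprn_continuous.
Qed.

Lemma integrable_halfdisk k : mu.-integrable `[-1, 1] (EFin \o halfdisk k).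
Proof.
apply: continuous_compact_integrable; first exact: segment_compact.
by apply: continuous_subspaceT; exact: continuous_halfdisk.
Qed.

Lemma wallis0 : wallis 0 = 2.
Proof.
rewrite /wallis /halfdisk; under eq_Rintegral do rewrite expr0.
rewrite Rintegral_cst//= lebesgue_measure_itv /= lte_fin ifT ?gtrN// /= mul1r; lra.
Qed.

Lemma wallis_nincr k : wallis k.+1 <= wallis k.
Proof.
apply: le_Rintegral => //; [exact: integrable_halfdisk..|move=> x _].
rewrite /halfdisk exprSr ler_piMr ?exprn_ge0 ?sqrtr_ge0//.
by rewrite -[leRHS]sqrtr1 ler_wsqrtr// lerBlDr lerDl sqr_ge0.
Qed.

(* The difference of the two sides is the integral of the derivative of
   [x * sqrt (1 - x^2)^(k+2)], which vanishes at both ends. *)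
Lemma wallisSS k : (k + 3)%:R * wallis k.+2 = (k + 2)%:R * wallis k.
Proof.
have cf : continuous (fun x => (k + 3)%:R * halfdisk k.+2 x - (k + 2)%:R * halfdisk k x).
  by move=> x; apply: cvgB; apply: cvgMr; exact: continuous_halfdisk.
have cF : continuous (fun x : R => x * halfdisk k.+2 x).
  by move=> x; apply: cvgM; [exact: cvg_id|exact: continuous_halfdisk].
have dF (x : R) : x \in `]-1, 1[ -> is_derive x 1 (fun x : R => x * halfdisk k.+2 x)
    ((k + 3)%:R * halfdisk k.+2 x - (k + 2)%:R * halfdisk k x).
  rewrite in_itv/= => /andP[x1 x2]; have x0 : 0 < 1 - x ^+ 2 by nra.
  have ds := @is_derive1_sqrt R _ x0.
  have dq : is_derive x 1 (fun x : R => 1 - x ^+ 2) (- (2 * x)).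
    by apply: is_derive_eq; rewrite /GRing.scale /=; ring.
  have dc := @is_derive1_comp R Num.sqrt (fun x : R => 1 - x ^+ 2) x _ _ ds dq.
  have -> : (fun x : R => x * halfdisk k.+2 x) =
      (id : R -> R) * (Num.sqrt \o (fun x : R => 1 - x ^+ 2)) ^+ k.+2.
    by apply/funext => y; rewrite /GRing.mul /= exprfctE.
  apply: is_derive_eq; rewrite /GRing.scale /= exprfctE /= /halfdisk.
  have := sqr_sqrtr (ltW x0); have : Num.sqrt (1 - x ^+ 2) != 0 by rewrite gt_eqF// sqrtr_gt0.
  move: (Num.sqrt _) => s s0 sE.
  have xE : x ^+ 2 = 1 - s ^+ 2 by rewrite sE; ring.
  rewrite [X in X + _](_ : _ = - ((k.+2)%:R * s ^+ k * x ^+ 2)); last first.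
    by rewrite exprS; field.
  by rewrite xE !exprS; ring.
have F1 y : y ^+ 2 = 1 -> y * halfdisk k.+2 y = 0.
  by move=> y1; rewrite /halfdisk y1 subrr sqrtr0 exprS mul0r mulr0.
have := @continuous_FTC2 R _ (fun x : R => x * halfdisk k.+2 x) (-1) 1 _ (continuous_subspaceT cf).
rewrite /= !F1 ?expr1n ?sqrrN ?expr1n// sube0 => FTC.
apply/eqP; rewrite -subr_eq0 /wallis -!RintegralZl//; [|exact: integrable_halfdisk..].
have iZ c j : mu.-integrable `[-1, 1] (EFin \o (fun x => c * halfdisk j x)).
  apply: continuous_compact_integrable; first exact: segment_compact.
  by apply: continuous_subspaceT => x; apply: cvgMr; exact: continuous_halfdisk.
rewrite -RintegralB//.
rewrite /Rintegral FTC//.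
- split; first by move=> x /dF [].
  + exact/cvg_at_right_filter/cF.
  + exact/cvg_at_left_filter/cF.
- by move=> x xI; rewrite derive1E; exact: (@derive_val _ _ _ _ _ _ _ (dF x xI)).
Qed.

(** The recurrence started at [wallis0] settles even indices; an odd one is bounded below by its
    even successor. *)
Lemma wallis_gt0 k : 0 < wallis k.
Proof.
have even_gt0 j : 0 < wallis (2 * j).
  elim: j => [|j IHj]; first by rewrite muln0 wallis0.
  have : 0 < (2 * j + 3)%:R * wallis (2 * j).+2.
    by rewrite wallisSS mulr_gt0// ltr0n addn2.
  by rewrite pmulr_rgt0 ?ltr0n ?addn3// mulnS.
have [ko|ke] := boolP (odd k).
  apply: lt_le_trans (wallis_nincr k).
  have -> : k.+1 = (2 * (k.+1)./2)%N by lia.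
  exact: even_gt0.
have -> : k = (2 * k./2)%N by lia.
exact: even_gt0.
Qed.

(** The power [k/2] of the positive part of [T]. The test matters for [k = 0]: it makes [rpow 0] the
    indicator of [0 <= T], whereas [Num.sqrt T ^+ 0] is always 1. *)
Definition rpow (k : nat) (T : R) : R := if 0 <= T then Num.sqrt T ^+ k else 0.

Lemma rpow_ge0 k T : 0 <= rpow k T.
Proof. by rewrite /rpow; case: ifP => // _; rewrite exprn_ge0// sqrtr_ge0. Qed.

Lemma measurable_rpow k : measurable_fun [set: R] (rpow k).
Proof.
apply: measurable_fun_ifT => //.
  by apply: measurable_fun_ler.
apply: measurable_funX; apply: continuous_measurable_fun; exact: sqrt_continuous.
Qed.

(** The substitution [x = r u] with [r = Num.sqrt T] extracts [r ^+ k.+1]; [r = 0] is treated apart,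
    since the substitution must be strictly increasing. *)
Lemma integral_rpow1 k T :
  (\int[mu]_x (rpow k (T - x ^+ 2))%:E = (wallis k * rpow k.+1 T)%:E)%E.
Proof.
have [T0|T0] := ltP T 0.
  rewrite {2}/rpow leNgt T0 /= mulr0 integral0_eq// => x _.
  by rewrite /rpow subr_ge0 leNgt (lt_le_trans T0 (sqr_ge0 x)).
set r := Num.sqrt T; have r0 : 0 <= r := sqrtr_ge0 T.
transitivity (\int[mu]_(x in `[(- r)%R, r]) (Num.sqrt (T - x ^+ 2) ^+ k)%:E)%E.
  rewrite [RHS]integral_mkcond; apply: eq_integral => x _.
  rewrite patchE /rpow subr_ge0 -{1}(sqr_sqrtr T0) -/r mem_setE in_itv /= -ler_norml.
  by rewrite -(@ler_sqr _ `|x|) ?nnegrE// real_normK ?num_real// (fun_if EFin).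
rewrite /rpow T0 -/r.
have [r00|rn0] := eqVneq r 0.
  by rewrite r00 oppr0 set_itv1 integral_set1 expr0n mulr0.
have {}r0 : 0 < r by rewrite lt_neqAle eq_sym rn0.
have dF (x : R) : is_derive x 1 (fun x : R => r * x) r.
  by apply: is_derive_eq; rewrite /GRing.scale /=; ring.
have F' : (fun x : R => r * x)^`()%classic = cst r.
  by apply/funext => x; rewrite derive1E; exact: (@derive_val _ _ _ _ _ _ _ (dF x)).
have cF : continuous (fun x : R => r * x) by exact: mulrl_continuous.
have -> : `[- r, r]%classic = `[r * -1, r * 1]%classic :> set R by rewrite mulrN mulr1.
rewrite (@integration_by_substitution_increasing R (fun x => r * x)); last 7 first.
- by rewrite (le_trans (lerN10 _)).
- by move=> x y _ _ xy; rewrite ltr_pM2l.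
- by rewrite F' => x _; exact: cvg_cst.
- by rewrite F'; exact: is_cvg_cst.
- by rewrite F'; exact: is_cvg_cst.
- split; first by move=> x _; have [] := dF x.
  + exact/cvg_at_right_filter/cF.
  + exact/cvg_at_left_filter/cF.
- apply: continuous_subspaceT => x.
  apply: (@continuous_comp _ _ _ (fun x : R => Num.sqrt (T - x ^+ 2)) (fun y => y ^+ k)).
    exact: continuous_sqrtB.
  exact: exprn_continuous.
rewrite F' (mulrC (wallis k)).
have -> : (r ^+ k.+1 * wallis k)%:E =
   (\int[mu]_(x in `[(-1)%R, 1%R]) ((r ^+ k.+1)%:E * (halfdisk k x)%:E))%E.
  rewrite integralZl//; last exact: integrable_halfdisk.
  rewrite EFinM /wallis /Rintegral fineK// integrable_fin_num//.
  exact: integrable_halfdisk.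
apply: eq_integral => x; rewrite inE /= in_itv /= => /andP[x1 x2].
rewrite -EFinM mulrfctE /=; congr EFin.
rewrite -(sqr_sqrtr T0) -/r exprMn -{1}[r ^+ 2]mulr1 -mulrBr sqrtrM ?sqr_ge0//.
by rewrite sqrtr_sqr gtr0_norm// exprMn [r ^+ k.+1]exprS /halfdisk; ring.
Qed.

End wallis.

(** * Integrals of radial functions over tuples *)

Section balls.
Context {R : realType}.
Local Notation mu := (@lebesgue_measure R).
Local Notation RT := (measurableTypeR R).

Definition sqnorm m (t : m.-tuple RT) : R := \sum_(i < m) tnth t i ^+ 2.

Lemma tnth_cons_pair0 m (x : RT) (t : m.-tuple RT) :
  tnth (cons_pair (x, t)) ord0 = x.
Proof. by rewrite (tnth_nth x). Qed.

Lemma tnth_cons_pairS m (x : RT) (t : m.-tuple RT) i :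
  tnth (cons_pair (x, t)) (lift ord0 i) = tnth t i.
Proof. by rewrite !(tnth_nth x). Qed.

Lemma sqnorm_cons m (x : RT) (t : m.-tuple RT) :
  sqnorm (cons_pair (x, t)) = x ^+ 2 + sqnorm t.
Proof.
rewrite /sqnorm big_ord_recl tnth_cons_pair0; congr (_ + _).
by apply: eq_bigr => i _; rewrite tnth_cons_pairS.
Qed.

Lemma measurable_sumsq m (P : pred 'I_m) :
  measurable_fun [set: m.-tuple RT] (fun t => \sum_(i < m | P i) tnth t i ^+ 2 : R).
Proof.
under eq_fun do rewrite big_mkcond /=.
apply: measurable_sum => i; case: (P i) => //.
by apply: measurable_funX; exact: measurable_tnth.
Qed.

Lemma measurable_sqnorm m : measurable_fun [set: m.-tuple RT] (@sqnorm m).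
Proof. exact: measurable_sumsq. Qed.

(** By [integral_rpow] at [T = 1], the integral of [(1 - |y|^2)^(k/2)] over [B^q]; [ball_coef 0 n]
    is the volume of [B^n]. *)
Definition ball_coef (k q : nat) : R := \prod_(i < q) wallis (k + i).

Lemma ball_coef_gt0 k q : 0 < ball_coef k q.
Proof. by apply: prodr_gt0 => i _; exact: wallis_gt0. Qed.

(** The outer coordinate [x] replaces [T] by [T - x^2], and each integration raises the exponent
    index by one, at the cost of one Wallis factor. *)
Lemma integral_rpow q k T :
  (\int[lebesgue_tuple q]_t (rpow k (T - sqnorm t))%:E
   = (ball_coef k q * rpow (k + q) T)%:E)%E.
Proof.
have mf m (T' : R) : measurable_fun [set: m.-tuple RT]
    (fun t => (rpow k (T' - sqnorm t))%:E).
  apply/measurable_EFinP; apply: measurableT_comp; first exact: measurable_rpow.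
  by apply: measurable_funB => //; exact: measurable_sqnorm.
elim: q T => [|q IHq] T.
  rewrite integral_lebesgue_tuple0// /ball_coef big_ord0 mul1r addn0.
  by rewrite /sqnorm big_ord0 subr0.
rewrite integral_lebesgue_tupleS//; last by move=> t; rewrite lee_fin rpow_ge0.
transitivity (\int[mu]_x ((ball_coef k q)%:E * (rpow (k + q) (T - x ^+ 2))%:E))%E.
  apply: eq_integral => x _; rewrite -EFinM -IHq; apply: eq_integral => t _.
  by rewrite sqnorm_cons opprD addrA.
rewrite ge0_integralZl//; first last.
- by rewrite lee_fin ltW// ball_coef_gt0.
- by move=> x _; rewrite lee_fin rpow_ge0.
- apply/measurable_EFinP; apply: measurableT_comp; first exact: measurable_rpow.
  by apply: measurable_funB => //; exact: measurable_funX.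
by rewrite integral_rpow1 -EFinM /ball_coef big_ord_recr/= addnS mulrA.
Qed.

Definition sqhead n q (t : (n + q).-tuple RT) : R :=
  \sum_(i < n + q | (i < n)%N) tnth t i ^+ 2.
Definition sqtail n q (t : (n + q).-tuple RT) : R :=
  \sum_(i < n + q | (n <= i)%N) tnth t i ^+ 2.

Lemma sqhead_cons n q (x : RT) (t : (n + q).-tuple RT) :
  @sqhead n.+1 q (cons_pair (x, t)) = x ^+ 2 + sqhead t.
Proof.
rewrite /sqhead big_mkcond [in RHS]big_mkcond big_ord_recl tnth_cons_pair0; congr (_ + _).
by apply: eq_bigr => i _; rewrite tnth_cons_pairS.
Qed.

Lemma sqtail_cons n q (x : RT) (t : (n + q).-tuple RT) :
  @sqtail n.+1 q (cons_pair (x, t)) = sqtail t.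
Proof.
rewrite /sqtail big_mkcond [in RHS]big_mkcond big_ord_recl /= add0r.
by apply: eq_bigr => i _; rewrite tnth_cons_pairS.
Qed.

Lemma measurable_pair_sqnorm n q (g : RT * RT -> \bar R) : measurable_fun setT g ->
  measurable_fun [set: n.-tuple RT * q.-tuple RT] (fun p => g (sqnorm p.1, sqnorm p.2)).
Proof.
move=> mg; apply: (measurableT_comp mg); apply/measurable_fun_pairP; split => /=.
  exact: measurableT_comp (@measurable_sqnorm n) measurable_fst.
exact: measurableT_comp (@measurable_sqnorm q) measurable_snd.
Qed.

(** Tonelli, by induction on [n] with [g] general: peeling off a coordinate [x] shifts the first
    argument of [g] by [x^2]. *)
Lemma integral_sqhead_sqtail n q (g : RT * RT -> \bar R) : measurable_fun setT g ->
  (forall p, 0 <= g p)%E ->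
  (\int[lebesgue_tuple (n + q)]_t g (sqhead t, sqtail t) =
   \int[lebesgue_tuple n]_x \int[lebesgue_tuple q]_y g (sqnorm x, sqnorm y))%E.
Proof.
have mh m m' (h : RT * RT -> \bar R) : measurable_fun setT h -> (forall p, 0 <= h p)%E ->
    measurable_fun [set: m.-tuple RT]
      (fun x => \int[lebesgue_tuple m']_y h (sqnorm x, sqnorm y))%E.
  move=> mh h0.
  exact: (measurable_fun_fubini_tonelli_F _ (@measurable_pair_sqnorm m m' h mh)).
elim: n g => [|n IHn] g mg g0.
  rewrite integral_lebesgue_tuple0; last exact: mh.
  apply: eq_integral => t _; congr (g (_, _)).
    by rewrite /sqnorm big_ord0 /sqhead big_pred0.
have mgA n' : measurable_fun [set: (n' + q).-tuple RT] (fun t => g (sqhead t, sqtail t)).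
  apply: (measurableT_comp mg); apply/measurable_fun_pairP; split; exact: measurable_sumsq.
rewrite [LHS](@integral_lebesgue_tupleS _ (n + q))//; last exact: (mgA n.+1).
rewrite integral_lebesgue_tupleS; [|exact: mh|by move=> x; exact: integral_ge0].
apply: eq_integral => x _.
under eq_integral do rewrite sqhead_cons sqtail_cons.
under [RHS]eq_integral do under eq_integral do rewrite sqnorm_cons.
apply: (IHn (fun p => g (x ^+ 2 + p.1, p.2))) => //.
apply: (measurableT_comp mg); apply/measurable_fun_pairP; split => //=.
  exact: measurable_funD.
exact: measurable_snd.
Qed.

End balls.

(** * Volume of the parallel body of B^n x 0^q *)

Section volume.
Context {R : realType}.
Local Notation mu := (@lebesgue_measure R).
Local Notation RT := (measurableTypeR R).

Definition rowhead n q (x : 'rV[R]_(n + q)) : R := \sum_(j < n + q | (j < n)%N) x 0 j ^+ 2.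
Definition rowtail n q (x : 'rV[R]_(n + q)) : R := \sum_(j < n + q | (n <= j)%N) x 0 j ^+ 2.

(* For t >= 0 this is the parallel body [B^n x 0^q + t B^(n+q)]: over a point with
   last coordinates y lies a ball of radius [1 + sqrt (t^2 - |y|^2)]. *)
Definition disk_parallel n q (t : R) : set 'rV[R]_(n + q) :=
  [set x | rowtail x <= t ^+ 2 /\
           Num.sqrt (rowhead x) <= 1 + Num.sqrt (t ^+ 2 - rowtail x)].

Definition disk_steiner n q : {poly R} :=
  \sum_(k < n.+1) ('C(n, k)%:R * ball_coef 0 n * ball_coef k q) *: 'X^(k + q).

Let profile (t : R) (p : RT * RT) : bool :=
  (p.2 <= t ^+ 2) && (Num.sqrt p.1 <= 1 + Num.sqrt (t ^+ 2 - p.2)).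

Let measurable_profile t : measurable_fun setT (profile t).
Proof.
have ms : measurable_fun [set: RT] (@Num.sqrt R).
  by apply: continuous_measurable_fun; exact: sqrt_continuous.
apply: measurable_and; apply: measurable_fun_ler => //.
  exact: measurableT_comp.
apply: measurable_funD => //; apply: measurableT_comp => //.
exact: measurable_funB.
Qed.

Let measurable_profileE t : measurable_fun setT (fun p => ((profile t p)%:R : R)%:E).
Proof.
apply/measurable_EFinP.
rewrite (_ : (fun p => _) = (fun p => if profile t p then 1 else 0 : R)); last first.
  by apply/funext => p; case: profile.
exact: measurable_fun_ifT.
Qed.

(** After exchanging the integrals, the fibre over [y] is a ball of radius [1 + r] with
    [r^2 = t^2 - |y|^2]. Its volume is expanded by the binomial theorem, and each power of [r] is
    integrated by [integral_rpow]. *)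
Lemma volume_disk_parallel n q (t : R) : 0 <= t ->
  volume (@disk_parallel n q t) = ((disk_steiner n q).[t])%:E.
Proof.
move=> t0; pose S := [set u : (n + q).-tuple RT | profile t (sqhead u, sqtail u)].
have mS : measurable S.
  have mp : measurable_fun [set: (n + q).-tuple RT] (fun u => profile t (sqhead u, sqtail u)).
    apply: (measurableT_comp (@measurable_profile t)).
    by apply/measurable_fun_pairP; split; exact: measurable_sumsq.
  rewrite -[S]setTI; exact: (mp measurableT [set true]).
rewrite /volume (_ : [set u | _] = S); last first.
  have hE u : rowhead (\row_i tnth u i : 'rV[R]_(n + q)) = sqhead u.
    by apply: eq_bigr => i _; rewrite mxE.
  have tE u : rowtail (\row_i tnth u i : 'rV[R]_(n + q)) = sqtail u.
    by apply: eq_bigr => i _; rewrite mxE.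
  apply/seteqP; split => u; rewrite /S /disk_parallel /profile /= hE tE.
    by move=> [-> ->].
  by move=> /andP.
rewrite -[S]setIT -(integral_indic _ measurableT mS).
transitivity (\int[lebesgue_tuple (n + q)]_u
    (fun p => ((profile t p)%:R : R)%:E) (sqhead u, sqtail u))%E.
  apply: eq_integral => u _; rewrite indicE.
  by have -> : (u \in S) = profile t (sqhead u, sqtail u) by apply/idP/idP; rewrite inE.
rewrite (@integral_sqhead_sqtail R n q (fun p => ((profile t p)%:R : R)%:E)
  (measurable_profileE t))//.
rewrite (fubini_tonelli (fun p : n.-tuple RT * q.-tuple RT =>
  ((profile t (sqnorm p.1, sqnorm p.2))%:R : R)%:E)) /=; last 2 first.
- exact: (@measurable_pair_sqnorm R n q _ (@measurable_profileE t)).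
- by move=> p; rewrite lee_fin.
have mrp k : measurable_fun [set: q.-tuple RT]
    (fun y => (rpow k (t ^+ 2 - sqnorm y))%:E).
  apply/measurable_EFinP; apply: measurableT_comp; first exact: measurable_rpow.
  by apply: measurable_funB => //; exact: measurable_sqnorm.
have c0 k : 0 <= 'C(n, k)%:R * ball_coef 0 n :> R.
  by rewrite mulr_ge0// ltW// ball_coef_gt0.
transitivity (\int[lebesgue_tuple q]_y
    \sum_(k < n.+1) (('C(n, k)%:R * ball_coef 0 n)%:E * (rpow k (t ^+ 2 - sqnorm y))%:E))%E.
  apply: eq_integral => y _; rewrite /fubini_G /=.
  have [yt|yt] := leP (sqnorm y) (t ^+ 2); last first.
    rewrite integral0_eq => [|x _]; last by rewrite /profile /= leNgt yt.
    by rewrite big1// => k _; rewrite /rpow subr_ge0 leNgt yt mule0.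
  set r := Num.sqrt (t ^+ 2 - sqnorm y); have r0 : 0 <= r := sqrtr_ge0 _.
  have r1 : 0 <= 1 + r by rewrite addr_ge0.
  transitivity (\int[lebesgue_tuple n]_x (rpow 0 ((1 + r) ^+ 2 - sqnorm x))%:E)%E.
    apply: eq_integral => x _; rewrite /profile /rpow /= yt /= -/r subr_ge0 expr0.
    rewrite -(@ler_sqr _ (Num.sqrt _)) ?nnegrE ?sqrtr_ge0// sqr_sqrtr; last first.
      by apply: sumr_ge0 => i _; exact: sqr_ge0.
    by case: ifP.
  rewrite integral_rpow add0n {1}/rpow sqr_ge0 sqrtr_sqr ger0_norm// sumEFin.
  rewrite addrC exprD1n mulr_sumr; congr EFin; apply: eq_bigr => k _.
  by rewrite /rpow subr_ge0 yt -/r; ring.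
rewrite ge0_integral_sum//; last 2 first.
- by move=> k; apply: measurable_funeM; exact: mrp.
- by move=> k y _; rewrite mule_ge0 ?lee_fin ?rpow_ge0.
rewrite /disk_steiner horner_sum -sumEFin; apply: eq_bigr => k _.
rewrite ge0_integralZl//; [|by move=> y _; rewrite lee_fin rpow_ge0|by rewrite lee_fin].
rewrite integral_rpow -EFinM hornerZ hornerXn /rpow sqr_ge0 sqrtr_sqr ger0_norm//.
by rewrite mulrA.
Qed.

End volume.

(** * The ellipsoid and its parallel bodies *)

Section minkowski.
Variables (R : rcfType) (I : finType) (P : pred I).
Implicit Types x y : I -> R.

Lemma cauchy_schwarz x y : \sum_(i | P i) x i * y i <=
  Num.sqrt (\sum_(i | P i) x i ^+ 2) * Num.sqrt (\sum_(i | P i) y i ^+ 2).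
Proof.
have X0 z : 0 <= \sum_(i | P i) z i ^+ 2 :> R by apply: sumr_ge0 => i _; exact: sqr_ge0.
set X := \sum_(i | P i) x i ^+ 2; set Y := \sum_(i | P i) y i ^+ 2.
set Z := \sum_(i | P i) _.
have z0 z : \sum_(i | P i) z i ^+ 2 = 0 -> forall i, P i -> z i = 0 :> R.
  move=> /psumr_eq0P h i Pi; apply/eqP; rewrite -sqrf_eq0; apply/eqP/h => // j _.
  exact: sqr_ge0.
have [/z0 x0|Xn0] := eqVneq X 0.
  by rewrite /Z big1 ?mulr_ge0 ?sqrtr_ge0// => i /x0 ->; rewrite mul0r.
have [/z0 y0|Yn0] := eqVneq Y 0.
  by rewrite /Z big1 ?mulr_ge0 ?sqrtr_ge0// => i /y0 ->; rewrite mulr0.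
have sX : 0 < Num.sqrt X by rewrite sqrtr_gt0 lt_neqAle eq_sym Xn0 X0.
have sY : 0 < Num.sqrt Y by rewrite sqrtr_gt0 lt_neqAle eq_sym Yn0 X0.
have := X0 (fun i => Num.sqrt Y * x i - Num.sqrt X * y i).
have -> : \sum_(i | P i) (Num.sqrt Y * x i - Num.sqrt X * y i) ^+ 2 =
    Num.sqrt Y ^+ 2 * X - 2 * (Num.sqrt X * Num.sqrt Y) * Z + Num.sqrt X ^+ 2 * Y.
  rewrite /X /Y /Z !mulr_sumr -sumrB -big_split /=; apply: eq_bigr => i _.
  by rewrite sqrrB /X /Y; ring.
have XE := sqr_sqrtr (X0 x : 0 <= X); have YE := sqr_sqrtr (X0 y : 0 <= Y).
move: sX sY XE YE; move: (Num.sqrt X) (Num.sqrt Y) => a b a0 b0 <- <-.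
rewrite [leRHS](_ : _ = 2 * (a * b) * (a * b - Z)); last by ring.
by rewrite pmulr_rge0 ?subr_ge0// mulr_gt0// mulr_gt0.
Qed.

Lemma minkowski_sqrt x y : Num.sqrt (\sum_(i | P i) (x i + y i) ^+ 2) <=
  Num.sqrt (\sum_(i | P i) x i ^+ 2) + Num.sqrt (\sum_(i | P i) y i ^+ 2).
Proof.
have X0 z : 0 <= \sum_(i | P i) z i ^+ 2 :> R by apply: sumr_ge0 => i _; exact: sqr_ge0.
rewrite -ler_sqr ?nnegrE ?addr_ge0 ?sqrtr_ge0// sqrrD !sqr_sqrtr ?X0//.
rewrite (eq_bigr (fun i => x i ^+ 2 + (x i * y i) *+ 2 + y i ^+ 2)); last first.
  by move=> i _; rewrite sqrrD.
by rewrite big_split /= big_split /= lerD2r lerD2l sumrMnl lerMn2r cauchy_schwarz.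
Qed.

End minkowski.

Section ellipsoid.
Context {R : realType}.
Variables (n q : nat).
Implicit Types (eps t : R) (x : 'rV[R]_(n + q)).

Lemma sum_head_tail (f : 'I_(n + q) -> R) :
  \sum_j f j = \sum_(j < n + q | (j < n)%N) f j + \sum_(j < n + q | (n <= j)%N) f j.
Proof.
rewrite (bigID (fun j : 'I_(n + q) => (j < n)%N)) /=; congr (_ + _).
by apply: eq_bigl => j; rewrite -leqNgt.
Qed.

Lemma ellipsoidE eps x : ellipsoid n q eps x <-> rowhead x + rowtail x / eps ^+ 2 <= 1.
Proof.
rewrite /ellipsoid /= sum_head_tail (eq_bigr (fun j => x 0 j ^+ 2)); last first.
  by move=> j ->; rewrite divr1.
rewrite [X in _ + X](_ : _ = rowtail x / eps ^+ 2)// /rowtail mulr_suml.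
by apply: eq_bigr => j; rewrite leqNgt => /negPf ->; rewrite exprMn exprVn.
Qed.

Lemma unit_ballE x : unit_ball (n + q) x <-> rowhead x + rowtail x <= 1.
Proof. by rewrite /unit_ball /= sum_head_tail. Qed.

Lemma rowhead_ge0 x : 0 <= rowhead x.
Proof. by apply: sumr_ge0 => j _; exact: sqr_ge0. Qed.

Lemma rowtail_ge0 x : 0 <= rowtail x.
Proof. by apply: sumr_ge0 => j _; exact: sqr_ge0. Qed.

Lemma sub_disk_parallel eps t : 0 < t ->
  @disk_parallel R n q t `<=` minkowski_add (ellipsoid n q eps) (dilation t (unit_ball (n + q))).
Proof.
move=> t0 x [xt]; set r := Num.sqrt (t ^+ 2 - _) => xr; have r0 : 0 <= r := sqrtr_ge0 _.
have r1 : 0 < 1 + r by rewrite ltr_pwDl.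
(* [a] takes the share [1/(1+r)] of the head and no tail, so it lies in the ellipsoid whatever [eps]
   is; [t *: b] is the rest, of squared norm at most [r^2 + rowtail x = t^2]. *)
pose a : 'rV[R]_(n + q) := \row_j (if (j < n)%N then x 0 j / (1 + r) else 0).
pose b : 'rV[R]_(n + q) := \row_j (if (j < n)%N then r * x 0 j / (1 + r) / t else x 0 j / t).
have ah : rowhead a = rowhead x / (1 + r) ^+ 2.
  rewrite /rowhead mulr_suml; apply: eq_bigr => j jn.
  by rewrite mxE jn exprMn exprVn.
have at0 : rowtail a = 0.
  by apply: big1 => j; rewrite leqNgt mxE => /negPf ->; rewrite expr0n.
have bh : rowhead b = (r / t) ^+ 2 * (rowhead x / (1 + r) ^+ 2).
  rewrite /rowhead mulr_suml mulr_sumr; apply: eq_bigr => j jn.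
  by rewrite mxE jn !exprMn !exprVn; ring.
have bt : rowtail b = rowtail x / t ^+ 2.
  rewrite /rowtail mulr_suml; apply: eq_bigr => j.
  by rewrite leqNgt mxE => /negPf ->; rewrite exprMn exprVn.
have h1 : rowhead x / (1 + r) ^+ 2 <= 1.
  rewrite ler_pdivrMr ?exprn_gt0// mul1r -(sqr_sqrtr (rowhead_ge0 x)).
  by rewrite ler_sqr ?nnegrE ?sqrtr_ge0 ?(ltW r1).
exists a; first by apply/ellipsoidE; rewrite at0 mul0r addr0 ah.
exists (t *: b); last first.
  apply/rowP => j; rewrite !mxE; case: ifP => _; last by field; rewrite gt_eqF.
  by field; rewrite !gt_eqF.
exists b => //; apply/unit_ballE; rewrite bh bt.
apply: (@le_trans _ _ ((r / t) ^+ 2 + rowtail x / t ^+ 2)).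
  by rewrite lerD2r -[leRHS]mulr1 ler_wpM2l// sqr_ge0.
rewrite exprMn exprVn -mulrDl /r sqr_sqrtr ?subr_ge0// subrK divff//.
by rewrite expf_neq0// gt_eqF.
Qed.

(** In the ellipsoid heads have norm at most 1 and tails at most [eps]. If [y] is the tail of the
    sum, [|y| <= eps + t |b_tail|] yields [t^2 |b_head|^2 <= (t + eps)^2 - |y|^2], which bounds the
    head norm, at most [1 + t |b_head|], as required. *)
Lemma parallel_sub_disk eps t : 0 < eps -> 0 <= t ->
  minkowski_add (ellipsoid n q eps) (dilation t (unit_ball (n + q))) `<=`
  @disk_parallel R n q (t + eps).
Proof.
move=> e0 t0 _ [e /ellipsoidE He [_ [b /unit_ballE Hb <-] <-]].
have := rowhead_ge0 e; have := rowtail_ge0 e; have := rowhead_ge0 b; have := rowtail_ge0 b.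
set b2 := rowtail b in Hb *; set b1 := rowhead b in Hb *.
set e2 := rowtail e in He *; set e1 := rowhead e in He * => b20 b10 e20 e10.
have e0' : 0 < eps ^+ 2 by rewrite exprn_gt0.
have e2d : 0 <= e2 / eps ^+ 2 by rewrite divr_ge0// ltW.
have e1_le : Num.sqrt e1 <= 1.
  by rewrite -[leRHS]sqrtr1 ler_wsqrtr// (le_trans _ He)// lerDl.
have e2_le : Num.sqrt e2 <= eps.
  rewrite -[leRHS]gtr0_norm// -sqrtr_sqr ler_wsqrtr// -[leRHS]mul1r -ler_pdivrMr//.
  by rewrite (le_trans _ He)// lerDr.
have b2_le : Num.sqrt b2 <= 1.
  by rewrite -[leRHS]sqrtr1 ler_wsqrtr// (le_trans _ Hb)// lerDr.
have tb (P : pred 'I_(n + q)) : Num.sqrt (\sum_(j | P j) (t * b 0 j) ^+ 2) =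
    t * Num.sqrt (\sum_(j | P j) b 0 j ^+ 2).
  under eq_bigr do rewrite exprMn.
  by rewrite -mulr_sumr sqrtrM ?sqr_ge0// sqrtr_sqr ger0_norm.
have H : Num.sqrt (rowhead (e + t *: b)) <= 1 + t * Num.sqrt b1.
  rewrite /rowhead; under eq_bigr do rewrite !mxE.
  by rewrite (le_trans (minkowski_sqrt _ _ _))// tb lerD2r.
have T : Num.sqrt (rowtail (e + t *: b)) <= eps + t * Num.sqrt b2.
  rewrite /rowtail; under eq_bigr do rewrite !mxE.
  by rewrite (le_trans (minkowski_sqrt _ _ _))// tb lerD2r.
have s0 := sqrtr_ge0 b2.
have tb2 : t * Num.sqrt b2 <= t by rewrite -[leRHS]mulr1 ler_wpM2l.
have T2 : rowtail (e + t *: b) <= (eps + t * Num.sqrt b2) ^+ 2.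
  rewrite -(sqr_sqrtr (rowtail_ge0 _)) ler_sqr ?nnegrE ?sqrtr_ge0//.
  by rewrite addr_ge0 ?mulr_ge0// ltW.
have T3 : rowtail (e + t *: b) <= (t + eps) ^+ 2 - (t * Num.sqrt b1) ^+ 2.
  apply: (le_trans T2); rewrite -subr_ge0.
  rewrite [leRHS](_ : _ = 2 * eps * (t - t * Num.sqrt b2) +
      t ^+ 2 * (1 - (Num.sqrt b1 ^+ 2 + Num.sqrt b2 ^+ 2))); last by ring.
  rewrite !sqr_sqrtr// addr_ge0// mulr_ge0 ?subr_ge0 ?sqr_ge0//.
  by rewrite mulr_ge0// ltW.
split; first by rewrite (le_trans T3)// gerBl sqr_ge0.
apply: (le_trans H); rewrite lerD2l -[leLHS]ger0_norm ?mulr_ge0 ?sqrtr_ge0//.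
by rewrite -sqrtr_sqr ler_wsqrtr// lerBrDr addrC -lerBrDr.
Qed.

Lemma steiner_squeeze eps t (S : {poly R}) : 0 < eps -> 0 < t ->
  is_steiner_polynomial (ellipsoid n q eps) S ->
  (disk_steiner n q).[t] <= S.[t] <= (disk_steiner n q).[t + eps].
Proof.
move=> e0 t0 [_ /(_ t (ltW t0)) St]; rewrite -!lee_fin -St.
have te0 : 0 <= t + eps by rewrite addr_ge0// ltW.
rewrite -(volume_disk_parallel n q (ltW t0)) -(volume_disk_parallel n q te0).
apply/andP; split; apply: le_volume.
  exact: sub_disk_parallel.
exact: parallel_sub_disk (ltW t0).
Qed.

End ellipsoid.

(** * The Gamma function *)

Section gamma.
Context {R : realType}.
Local Notation mu := (@lebesgue_measure R).

Definition gamma_integrand (a t : R) : R := t `^ a * expR (- t).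
(** Up to a constant, an integrable majorant of the Gamma integrands. *)
Definition exph (t : R) : R := expR (- (t / 2)).

Lemma is_derive_exph (t : R) : is_derive t 1 exph (- (exph t / 2)).
Proof.
have d1 : is_derive t 1 (fun t : R => - (t / 2)) (- 2^-1).
  by apply: is_derive_eq; rewrite /GRing.scale /=; ring.
have d2 := @is_derive_expR R (- (t / 2)).
have := @is_derive1_comp R expR (fun t : R => - (t / 2)) t _ _ d2 d1.
by rewrite mulrN.
Qed.

Lemma continuous_exph : continuous exph.
Proof.
move=> t; apply/differentiable_continuous/derivable1_diffP.
by have [] := is_derive_exph t.
Qed.

Lemma cvg_exph : exph t @[t --> +oo] --> 0.
Proof.
apply: (@cvg_comp _ _ _ (fun t : R => t / 2) (fun t => expR (- t)) _ (pinfty_nbhs R));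
  last exact: cvgr_expR.
apply/cvgryPge => A; near=> t; rewrite ler_pdivlMr//; near: t; exact: nbhs_pinfty_ge.
Unshelve. all: by end_near. Qed.

Lemma integral_exph : (\int[mu]_(t in `[0%R, +oo[) (exph t)%:E = 2%:E)%E.
Proof.
rewrite (@ge0_continuous_FTC2y R exph (fun t => - 2 * exph t) 0 0).
- by rewrite /exph mul0r oppr0 expR0 mulr1 add0e -EFinN opprK.
- by move=> t _; exact: expR_ge0.
- by apply: continuous_subspaceT; exact: continuous_exph.
- by rewrite -[X in _ --> X](mulr0 (- 2)); apply: cvgMr; exact: cvg_exph.
- move=> t _; apply: derivableM => //; by have [] := is_derive_exph t.
- by apply: cvg_at_right_filter; apply: cvgMr; exact: continuous_exph.
- move=> t _; have d := is_derive_exph t.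
  rewrite derive1E.
  have -> : (fun t : R => - 2 * exph t) = (fun t => (- 2) *: exph t) by [].
  rewrite deriveZ; last by have [] := d.
  by rewrite derive_val /GRing.scale /=; field.
Qed.

Lemma integrable_exph : mu.-integrable `[0, +oo[ (EFin \o exph).
Proof.
apply/integrableP; split.
  apply/measurable_EFinP; apply: measurable_funTS.
  by apply: continuous_measurable_fun; exact: continuous_exph.
under eq_integral do rewrite /= ger0_norm ?expR_ge0//.
by rewrite integral_exph ltry.
Qed.

(** From [1 + u <= exp u] one gets [t <= 2a exp(t/(2a))]; raise this to the power [a]. *)
Lemma gamma_integrand_le a t : 0 < a -> 0 <= t ->
  gamma_integrand a t <= (2 * a) `^ a * exph t.
Proof.
move=> a0 t0; rewrite /gamma_integrand /exph.
have a2 : 0 < 2 * a by rewrite mulr_gt0.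
have -> : expR (- (t / 2)) = expR (t / 2) * expR (- t).
  by rewrite -expRD; congr expR; lra.
rewrite mulrA ler_wpM2r ?expR_ge0//.
have : t <= 2 * a * expR (t / (2 * a)).
  rewrite mulrC -ler_pdivrMr//; apply: le_trans (expR_ge1Dx _); rewrite lerDr; lra.
move=> /(ge0_ler_powR (ltW a0)); rewrite !nnegrE => /(_ t0) h.
apply: (le_trans (h _)); first by rewrite mulr_ge0 ?expR_ge0// ltW.
rewrite powRM ?expR_ge0 ?(ltW a2)// -expRM.
by have -> : t / (2 * a) * a = t / 2 by field; rewrite gt_eqF.
Qed.

Lemma measurable_gamma_integrand a (D : set R) : measurable_fun D (gamma_integrand a).
Proof.
apply: measurable_funTS; apply: measurable_funM; first exact: measurable_powR.
by apply: measurableT_comp => //; exact: measurable_funN.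
Qed.

Lemma integrable_gamma a : 0 < a -> mu.-integrable `[0, +oo[ (EFin \o gamma_integrand a).
Proof.
move=> a0; apply: (@le_integrable _ _ _ mu _ _ _
    (fun t => ((2 * a) `^ a)%:E * (EFin \o exph) t)%E) => //.
- by apply/measurable_EFinP; exact: measurable_gamma_integrand.
- move=> t; rewrite /= in_itv /= andbT => t0.
  rewrite lee_fin !ger0_norm ?gamma_integrand_le// ?mulr_ge0 ?powR_ge0 ?expR_ge0//.
- exact/integrableZl/integrable_exph.
Qed.


Lemma is_derive_gamma_integrand a (t : R) : 0 < t ->
  is_derive t 1 (gamma_integrand a) (a * gamma_integrand (a - 1) t - gamma_integrand a t).
Proof.
move=> t0.
have d1 := @is_derive1_powR R a t t0.
have d2 : is_derive t 1 (fun t : R => - t) (- 1) by apply: is_derive_eq.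
have d3 := @is_derive1_comp R expR (fun t : R => - t) t _ _ (@is_derive_expR R (- t)) d2.
have := @is_deriveM R _ _ _ t 1 _ _ d1 d3.
rewrite (_ : _ + _ = a * gamma_integrand (a - 1) t - gamma_integrand a t)//.
by rewrite /gamma_integrand /GRing.scale /=; ring.
Qed.

Lemma cvg_gamma_integrand0 a : 0 < a -> gamma_integrand a t @[t --> 0^'+] --> 0.
Proof.
move=> a0; rewrite -[X in _ --> X](mul0r (expR (- 0))).
apply: cvgM; first exact: powR_cvg0.
apply: cvg_at_right_filter; apply: (@continuous_comp _ _ _ (fun t : R => - t) expR).
  exact: opp_continuous.
exact: continuous_expR.
Qed.

Lemma gamma_integrand0 a : 0 < a -> gamma_integrand a 0 = 0.
Proof. by move=> a0; rewrite /gamma_integrand powR0 ?gt_eqF// mul0r. Qed.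

Lemma continuous_gamma_integrand a : 0 < a ->
  {within `[0, +oo[, continuous (gamma_integrand a)}.
Proof.
move=> a0; apply/continuous_within_itvcyP; split.
  move=> t; rewrite in_itv /= andbT => t0.
  apply/differentiable_continuous/derivable1_diffP.
  by have [] := is_derive_gamma_integrand a t0.
by rewrite gamma_integrand0//; exact: cvg_gamma_integrand0.
Qed.

(* [h] below is the derivative of [- t^(a+1) e^(-t)], made nonnegative by a
   multiple of [e^(-t/2)]. *)
Lemma integral_gammaD1 a : 0 < a ->
  \int[mu]_(t in `[0, +oo[) gamma_integrand (a + 1) t =
  (a + 1) * \int[mu]_(t in `[0, +oo[) gamma_integrand a t.
Proof.
move=> a0.
have a1 : 0 < a + 1 by rewrite addr_gt0.
(* By [gamma_integrand_le], [K * exph] dominates [(a + 1) * gamma_integrand a]. *)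
pose K := (a + 1) * (2 * a) `^ a.
have K0 : 0 <= K by rewrite mulr_ge0 ?powR_ge0// ltW.
have g0 b t : 0 <= gamma_integrand b t by rewrite mulr_ge0 ?powR_ge0 ?expR_ge0.
pose h t : R := gamma_integrand (a + 1) t - (a + 1) * gamma_integrand a t + K * exph t.
pose H t : R := - gamma_integrand (a + 1) t - 2 * K * exph t.
have dH (t : R) : 0 < t -> is_derive t 1 H (h t).
  move=> t0; have d1 := is_derive_gamma_integrand (a + 1) t0.
  have d2 := is_derive_exph t.
  have -> : H = - gamma_integrand (a + 1) - (2 * K) *: exph by [].
  by apply: is_derive_eq; rewrite addrK /GRing.scale /= /h; field.
have Ih : (\int[mu]_(t in `[0%R, +oo[) (h t)%:E = (2 * K)%:E)%E.
  rewrite (@ge0_continuous_FTC2y R h H 0 0).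
  - have -> : H 0 = - (2 * K).
      by rewrite /H gamma_integrand0// /exph mul0r oppr0 expR0; ring.
    by rewrite -EFinN opprK add0e.
  - move=> t t0; rewrite /h -addrA addr_ge0// addrC subr_ge0 /K -mulrA.
    by rewrite ler_wpM2l ?(ltW a1)// gamma_integrand_le.
  - move=> t; apply: cvgD; last by apply: cvgMr; exact: (continuous_subspaceT continuous_exph).
    apply: cvgB; first exact: continuous_gamma_integrand.
    by apply: cvgMr; exact: continuous_gamma_integrand.
  - rewrite /H -[X in _ --> X](subrr 0) -[X in _ - X](mulr0 (2 * K)); apply: cvgB.
      rewrite -[X in _ --> X]oppr0; apply: cvgN.
      apply: (@squeeze_cvgr _ _ _ _ (fun=> 0) (fun t => (2 * (a + 1)) `^ (a + 1) * exph t)).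
      + near=> t; have t0 : 0 <= t by near: t; exact: nbhs_pinfty_ge.
        by rewrite g0 gamma_integrand_le.
      + exact: cvg_cst.
      + by rewrite -[X in _ --> X](mulr0 ((2 * (a + 1)) `^ (a + 1))); apply: cvgMr; exact: cvg_exph.
    by apply: cvgMr; exact: cvg_exph.
  - by move=> t /dH [].
  - apply: cvgB.
      apply: cvgN; rewrite gamma_integrand0//; exact: cvg_gamma_integrand0.
    by apply: cvg_at_right_filter; apply: cvgMr; exact: continuous_exph.
  - move=> t; rewrite in_itv /= andbT => /dH d.
    by rewrite derive1E; exact: (@derive_val _ _ _ _ _ _ _ d).
have ig b (c : R) : 0 < b -> mu.-integrable `[0, +oo[ (EFin \o (fun t => c * gamma_integrand b t)).
  move=> b0.
  rewrite (_ : EFin \o _ = fun t => (c%:E * (EFin \o gamma_integrand b) t)%E)//.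
  by apply: integrableZl => //; exact: integrable_gamma.
have ie : mu.-integrable `[0, +oo[ (EFin \o (fun t => K * exph t)).
  rewrite (_ : EFin \o _ = fun t => (K%:E * (EFin \o exph) t)%E)//.
  by apply: integrableZl => //; exact: integrable_exph.
have : \int[mu]_(t in `[0, +oo[) h t = 2 * K by rewrite /Rintegral Ih.
rewrite /h RintegralD//; last first.
  rewrite (_ : EFin \o _ = fun t => ((EFin \o gamma_integrand (a + 1)%R) t -
    (EFin \o (fun t => (a + 1) * gamma_integrand a t)%R) t)%E)//.
  by apply: integrableB => //; [exact: integrable_gamma|exact: ig].
rewrite RintegralB//; [|exact: integrable_gamma|exact: ig].
rewrite !RintegralZl//; [|exact: integrable_exph|exact: integrable_gamma].
have -> : \int[mu]_(t in `[0, +oo[) exph t = 2 by rewrite /Rintegral integral_exph.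
lra.
Unshelve. all: by end_near. Qed.

(** [1 < x] makes the exponent positive, hence the integrand continuous at 0. For [p >= 1] the Weyl
    polynomials only use Gamma at such arguments. *)
Lemma GammaE (x : R) : 1 < x ->
  Gamma x = \int[mu]_(t in `[0, +oo[) gamma_integrand (x - 1) t.
Proof.
move=> x1; rewrite /Gamma Rintegral_itv_obnd_cbnd//.
apply: (@integrableS _ _ _ mu `[0, +oo[) => //; last first.
  by apply: integrable_gamma; rewrite subr_gt0.
by move=> t; rewrite /= !in_itv /= !andbT; exact: ltW.
Qed.

Lemma GammaD1 (x : R) : 1 < x -> Gamma (x + 1) = x * Gamma x.
Proof.
move=> x1; rewrite !GammaE//; last by lra.
have -> : x + 1 - 1 = (x - 1) + 1 by ring.
by rewrite integral_gammaD1 ?subr_gt0// subrK.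
Qed.

(** On [[1, 2]] the power of [t] is at least 1, so the integrand is at least [expR (- 2)]. *)
Lemma Gamma_gt0 (x : R) : 1 < x -> 0 < Gamma x.
Proof.
move=> x1; rewrite GammaE//; set a := x - 1; have a0 : 0 < a by rewrite subr_gt0.
have ia := integrable_gamma a0.
have g0 t : 0 <= gamma_integrand a t by rewrite mulr_ge0 ?powR_ge0 ?expR_ge0.
rewrite /Rintegral fine_gt0//; apply/andP; split; last first.
  by rewrite ltey_eq integrable_fin_num.
apply: (@lt_le_trans _ _ (\int[mu]_(t in `[1%R, 2%R]) (expR (- 2))%:E)%E).
  rewrite integral_cst//= lebesgue_measure_itv/= lte_fin ltr1n -EFinB -EFinM lte_fin.
  by rewrite mulr_gt0 ?expR_gt0//; lra.
apply: (@le_trans _ _ (\int[mu]_(t in `[1%R, 2%R]) (gamma_integrand a t)%:E)%E).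
  apply: ge0_le_integral => //.
  - by apply/measurable_EFinP; exact: measurable_gamma_integrand.
  - move=> t; rewrite /= in_itv /= lee_fin => /andP[t1 t2].
    rewrite -[leLHS]mul1r ler_pM ?expR_ge0//; last by rewrite ler_expR lerN2.
    by rewrite -(powRr0 t) ler_powR// ltW.
apply: ge0_subset_integral => //.
- by apply/measurable_EFinP; exact: measurable_gamma_integrand.
- by move=> t _; rewrite lee_fin.
- by move=> t; rewrite /= !in_itv /= andbT => /andP[t1 _]; rewrite (le_trans _ t1).
Qed.

End gamma.

(** * Convergence of the coefficients as the ellipsoid degenerates *)

(** Lagrange interpolation at [1, ..., m + 1] makes each coefficient a fixed linear combination of
    the values there. The nodes avoid 0 because [steiner_squeeze] asks for [0 < t]. *)
Lemma coef_interpolation_bound (R : realFieldType) m : exists2 K : R, 0 < K &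
  forall (D : {poly R}) (e : R), (size D <= m.+1)%N ->
    (forall i, (i <= m)%N -> `|D.[i.+1%:R]| <= e) ->
    forall k, (k <= m)%N -> `|D`_k| <= K * e.
Proof.
pose x (i : nat) : R := i.+1%:R.
have xi : injective x by move=> i j /eqP; rewrite eqr_nat eqSS => /eqP.
pose lag (i : 'I_m.+1) : {poly R} := tnth (lagrange m.+1 x) i.
pose K0 := \sum_(k < m.+1) \sum_(i < m.+1) `|(lag i)`_k|.
have K0ge0 : 0 <= K0 by apply: sumr_ge0 => k _; apply: sumr_ge0.
exists (K0 + 1); first by rewrite ltr_wpDl.
move=> D e sD De k km.
have e0 : 0 <= e by rewrite (le_trans _ (De 0%N _)).
have -> : D`_k = \sum_(i < m.+1) D.[x i] * (lag i)`_k.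
  rewrite {1}(lagrange_gen (isT : (0 < m.+1)%N) xi sD) coef_sum.
  by apply: eq_bigr => i _; rewrite coefCM.
apply: (@le_trans _ _ (\sum_(i < m.+1) `|(lag i)`_k| * e)).
  apply: le_trans (ler_norm_sum _ _ _) _; apply: ler_sum => i _.
  by rewrite normrM mulrC ler_wpM2l// De// -ltnS.
rewrite -mulr_suml ler_wpM2r//.
apply: (@le_trans _ _ K0); last by rewrite lerDl.
rewrite /K0 [leRHS](bigD1 (Ordinal (km : (k < m.+1)%N)))//= lerDl.
by apply: sumr_ge0 => j _; apply: sumr_ge0.
Qed.

Section steiner_limit.
Context {R : realType}.

Lemma horner_shift_small (p : {poly R}) (e : R) m : 0 < e ->
  exists2 d : R, 0 < d & forall h i, 0 < h <= d -> (i <= m)%N ->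
    `|p.[i.+1%:R + h] - p.[i.+1%:R]| <= e.
Proof.
move=> e0; elim: m => [|m [d d0 IHd]].
  have /cvgrPdist_le/(_ e e0)/nbhs_normP[/= r r0 rP] := @continuous_horner R p 1.
  exists (r / 2); first by rewrite divr_gt0.
  move=> h i /andP[h0 hr]; rewrite leqn0 => /eqP ->.
  rewrite distrC; apply: rP; rewrite /= opprD addrA subrr sub0r normrN gtr0_norm//.
  rewrite (le_lt_trans hr)//; move: (r0 : 0 < r) => ?; lra.
have /cvgrPdist_le/(_ e e0)/nbhs_normP[/= r r0 rP] := @continuous_horner R p m.+2%:R.
have r0' : 0 < r by [].
exists (Num.min d (r / 2)); first by rewrite lt_min d0 divr_gt0.
move=> h i /andP[h0]; rewrite le_min => /andP[hd hr].
rewrite leq_eqVlt => /predU1P[->|im]; last by apply: IHd; rewrite ?h0.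
rewrite distrC; apply: rP; rewrite /= opprD addrA subrr sub0r normrN gtr0_norm//; lra.
Qed.

Lemma disk_steiner_coef n q i : (disk_steiner n q)`_i =
  if (q <= i)%N then 'C(n, i - q)%:R * ball_coef 0 n * ball_coef (i - q) q else 0 :> R.
Proof.
rewrite /disk_steiner coef_sum.
under eq_bigr do rewrite coefZ coefXn.
case: leqP => [qi|iq]; last first.
  by rewrite big1// => k _; rewrite (_ : (i == k + q)%N = false) ?mulr0//; lia.
have [ni|ni] := ltnP (i - q) n.+1; last first.
  rewrite bin_small// !mul0r big1// => k _.
  by rewrite (_ : (i == k + q)%N = false) ?mulr0//; have := ltn_ord k; lia.
rewrite (bigD1 (Ordinal ni))//= subnK// eqxx mulr1 big1 ?addr0// => k kn.
rewrite (_ : (i == k + q)%N = false) ?mulr0//; apply/negbTE.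
by apply/negP => /eqP iE; case/negP: kn; apply/eqP/val_inj; rewrite /= iE addnK.
Qed.

Lemma size_disk_steiner n q : size (@disk_steiner R n q) = (n + q).+1.
Proof.
apply/eqP; rewrite eqn_leq; apply/andP; split.
  apply/leq_sizeP => j nj; rewrite disk_steiner_coef; case: ifP => // _.
  by rewrite bin_small ?mul0r//; lia.
rewrite ltnNge; apply/negP => /leq_sizeP/(_ (n + q)%N (leqnn _)) /eqP.
by rewrite disk_steiner_coef leq_addl addnK binn mul1r mulf_eq0 !gt_eqF ?ball_coef_gt0.
Qed.

(** At each node [steiner_squeeze] bounds the error by the increment of [disk_steiner] over a step
    [eps]; interpolation carries this to the coefficients. *)
Lemma steiner_coef_cvg n q (d : R) : 0 < d -> exists2 eps0 : R, 0 < eps0 &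
  forall eps, 0 < eps <= eps0 ->
  forall S, is_steiner_polynomial (ellipsoid n q eps) S ->
  forall k, (k <= n + q)%N -> `|S`_k - (disk_steiner n q)`_k| <= d.
Proof.
move=> d0; have [K K0 HK] := @coef_interpolation_bound R (n + q).
have [e0 e00 He] := @horner_shift_small (disk_steiner n q) (d / K) (n + q) (divr_gt0 d0 K0).
exists e0 => // eps epsb S HS k km.
have eps_gt0 : 0 < eps by case/andP: epsb.
have /HK : (size (S - disk_steiner n q)%R <= (n + q).+1)%N.
  rewrite (leq_trans (size_polyD _ _))// geq_max size_polyN size_disk_steiner leqnn andbT.
  by case: HS.
move=> /(_ (d / K)) H; rewrite -coefB (le_trans (H _ _ km))//; last first.
  by rewrite mulrC divfK// gt_eqF.
move=> i im; rewrite hornerD hornerN.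
have ti : 0 < i.+1%:R :> R by rewrite ltr0n.
have /andP[S1 S2] := steiner_squeeze eps_gt0 ti HS.
rewrite ger0_norm ?subr_ge0//.
have := He eps i epsb im; rewrite ger0_norm ?subr_ge0 ?(le_trans S1)//.
by apply: le_trans; rewrite lerD2r.
Qed.

(** The Wallis recurrence is multiplied over all factors; the ratios [(k + i + 2)/(k + i + 3)]
    telescope. *)
Lemma ball_coefSS k q : (k + q + 2)%:R * ball_coef k.+2 q = (k + 2)%:R * ball_coef k q :> R.
Proof.
elim: q => [|q IHq]; first by rewrite /ball_coef !big_ord0 addn0.
rewrite /ball_coef !big_ord_recr /= -!/(ball_coef _ _).
have := @wallisSS R (k + q); rewrite -!addSn.
have -> : (k + q.+1 + 2 = k + q + 3)%N by lia.
move: (k + q + 3)%:R (k + q + 2)%:R (k + 2)%:R (wallis _) (wallis _)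
  (ball_coef _ _) (ball_coef _ _) IHq.
by move=> a b c w w' f f' h1 h2; rewrite mulrCA h2 mulrCA mulrA h1 -mulrA.
Qed.

Lemma ball_coef_even j q : ball_coef (2 * j) q = ball_coef 0 q * gamma_ratio R q j.
Proof.
elim: j => [|j IHj]; first by rewrite muln0 gamma_ratio0 mulr1.
have := ball_coefSS (2 * j) q; rewrite gamma_ratioS mulrA -IHj.
have -> : (2 * j).+2 = (2 * j.+1)%N by lia.
have -> : (2 * j + q + 2 = 2 * j.+1 + q)%N by lia.
have -> : (2 * j + 2 = 2 * j.+1)%N by lia.
have : (2 * j.+1 + q)%:R != 0 :> R by rewrite pnatr_eq0; lia.
by move=> h e; apply: (mulfI h); rewrite e; field.
Qed.

End steiner_limit.

(** * Roots of the limit Steiner polynomial *)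

Section complex_limit.
Context {R : realType}.
Local Notation toC := (map_poly (real_complex R)).

Lemma root_near m (P : {poly R}) (z0 d : R[i]) : size P = m.+1 -> root (toC P) z0 ->
  0 < d -> exists2 e : R, 0 < e & forall Q : {poly R}, (size Q <= m.+1)%N ->
    (forall k, (k <= m)%N -> `|Q`_k - P`_k| <= e) ->
    exists2 z, root (toC Q) z & `|z - z0| < d.
Proof.
move=> sP rP d0.
have sP' : size (toC P) = m.+1 by rewrite size_map_poly.
have [e e0 He] := root_continuity sP' rP d0.
have eE : (complex.Re e)%:C%C = e by rewrite RRe_real// gtr0_real.
exists (complex.Re e); first by rewrite -ltcR eE.
move=> Q sQ QP; apply: He; first by rewrite size_map_poly.
move=> k km; rewrite !coef_map -rmorphB /= -eE.
rewrite normc_def /= expr0n addr0 sqrtr_sqr lecR.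
exact: QP.
Qed.

(** The open disc about [z0] of radius [|Re z0|] does not meet the imaginary axis. *)
Lemma near_Re (z z0 : R[i]) : `|z - z0| < `|complex.Re z0|%:C%C ->
  (complex.Re z != 0) /\ (0 < complex.Re z0 -> 0 < complex.Re z).
Proof.
move=> /(le_lt_trans (normc_ge_Re _)); rewrite ltcR.
have -> : complex.Re (z - z0) = complex.Re z - complex.Re z0.
  by case: z z0 => [a b] [c d].
set a := complex.Re z; set b := complex.Re z0 => h; split.
  by apply: contraTneq h => ->; rewrite sub0r normrN ltxx.
move=> b0; move: h; rewrite (gtr0_norm b0) ltr_norml => /andP[h _]; lra.
Qed.

Lemma disk_steiner_root q : (5 <= q)%N -> exists N, forall n, (0 < n)%N -> (N <= n)%N ->
  exists2 z, root (toC (disk_steiner n q)) z & 0 < complex.Re z.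
Proof.
move=> q5; have [N HN] := @disk_even_root R q q5; exists N => n n0 /HN[z0 rz0 z0n].
(* Without the factor ['X^q] all coefficients up to the degree are positive, as
   [hermite_biehler_even] requires, and the even part is a multiple of [disk_even]. *)
pose core : {poly R} := \poly_(k < n.+1) ('C(n, k)%:R * ball_coef 0 n * ball_coef k q).
have coreE : disk_steiner n q = 'X^q * core.
  apply/polyP => i; rewrite disk_steiner_coef coefXnM ltnNge; case: leqP => //= qi.
  by rewrite coef_poly; case: ltnP => // h; rewrite bin_small// !mul0r.
have corepos k : (k < n.+1)%N -> 0 < core`_k.
  move=> kn; rewrite coef_poly kn; rewrite mulr_gt0 ?ball_coef_gt0// mulr_gt0 ?ball_coef_gt0//.
  by rewrite ltr0n bin_gt0 -ltnS.
have score : size core = n.+1.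
  by apply: size_poly_eq; have := corepos n (leqnn _); rewrite coef_poly leqnn => /lt0r_neq0.
have c0 : core != 0 by rewrite -size_poly_eq0 score.
have evenE : even_poly (toC core) = toC ((ball_coef 0 n * ball_coef 0 q) *: disk_even R q n).
  apply/polyP => j; rewrite coef_even_poly !coef_map coefZ disk_even_coef coef_poly -mul2n.
  case: ltnP => h /=; last by rewrite bin_small// mul0r mulr0.
  by rewrite ball_coef_even; congr (_%:C)%C; ring.
have [s [_ rs]] := @root_factors _ (toC core) (ltac:(by rewrite map_poly_eq0)).
have [/allP sP|/allPn[z zs zRe]] := boolP (all (fun z => 'Re z <= 0) s).
  case/negP: z0n; apply: (@hermite_biehler_even _ (toC core)).
  - by rewrite size_map_poly score.
  - by move=> k; rewrite size_map_poly score => /corepos; rewrite coef_map ltcR.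
  - by move=> z; rewrite rs => /sP.
  - rewrite evenE map_polyZ rootZ// fmorph_eq0.
    by rewrite mulf_neq0 ?gt_eqF ?ball_coef_gt0.
exists z; last by rewrite -ltcR complexRe (real_ltNge (real0 _) (Creal_Re _)).
by rewrite coreE rmorphM rootM rs zs orbT.
Qed.

End complex_limit.

(** * Weyl polynomials and their limit *)

Section weyl.
Context {R : realType}.
Local Notation toC := (map_poly (real_complex R)).

Definition weyl_weight (p l : nat) : R :=
  2 ^- l * Gamma (p%:R / 2 + 1) / Gamma (p%:R / 2 + l%:R + 1)
  * (2 ^+ l * (Gamma (l%:R + 2^-1 + 1) / Gamma (2^-1 + 1))).

Definition weyl_poly (m p : nat) (S : {poly R}) : {poly R} :=
  \sum_(l < (m.-1)./2.+1) (weyl_weight p l * S`_(2 * l).+1) *: 'X^(2 * l).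

Lemma is_weyl_polyE m p (V : set 'rV[R]_m) W : is_weyl_polynomial p V W ->
  exists2 S, is_steiner_polynomial V S & W = weyl_poly m p S.
Proof.
move=> [S HS ->]; exists S => //; apply: eq_bigr => l _; congr (_ *: _).
exact: mulrA.
Qed.

Lemma weyl_weight_gt0 p l : (0 < p)%N -> 0 < weyl_weight p l.
Proof.
move=> p0; have p0' : 0 < p%:R :> R by rewrite ltr0n.
have l0 : 0 <= l%:R :> R by [].
have G x : 0 < x -> 0 < Gamma (x + 1 : R) by move=> x0; apply: Gamma_gt0; rewrite ltrDr.
apply: mulr_gt0.
  apply: divr_gt0; last by apply: G; rewrite ltr_wpDr// divr_gt0.
  apply: mulr_gt0; first by rewrite invr_gt0 exprn_gt0.
  by apply: G; rewrite divr_gt0.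
apply: mulr_gt0; first exact: exprn_gt0.
by apply: divr_gt0; apply: G => //; rewrite ltr_wpDl.
Qed.

Lemma weyl_weightS p l : (0 < p)%N ->
  weyl_weight p l.+1 = weyl_weight p l * ((2 * l + 3)%:R / (2 * l + p + 2)%:R).
Proof.
move=> p0; have p0' : 0 < p%:R :> R by rewrite ltr0n.
have l0 : 0 <= l%:R :> R by [].
rewrite /weyl_weight.
have -> : p%:R / 2 + l.+1%:R + 1 = (p%:R / 2 + l%:R + 1) + 1 :> R by rewrite -natr1; ring.
have -> : l.+1%:R + 2^-1 + 1 = (l%:R + 2^-1 + 1) + 1 :> R by rewrite -natr1; ring.
rewrite (@GammaD1 _ (p%:R / 2 + l%:R + 1)) ?(@GammaD1 _ (l%:R + 2^-1 + 1)); [|lra..].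
have G2 : Gamma (p%:R / 2 + l%:R + 1 : R) != 0 by rewrite gt_eqF// Gamma_gt0//; lra.
have G4 : Gamma (2^-1 + 1 : R) != 0 by rewrite gt_eqF// Gamma_gt0//; lra.
move: G2 G4; move: (Gamma _) (Gamma _) (Gamma _) (Gamma _) => g1 g2 g3 g4 G2 G4.
have e1 : p%:R / 2 + l%:R + 1 = (2 * l + p + 2)%:R / 2 :> R.
  by rewrite natrD (natrD _ (2 * l)) natrM; field.
have e2 : l%:R + 2^-1 + 1 = (2 * l + 3)%:R / 2 :> R by rewrite natrD natrM; field.
have h1 : (2 * l + p + 2)%:R != 0 :> R by rewrite pnatr_eq0; lia.
have h2 : 2 ^+ l != 0 :> R by rewrite expf_neq0.
rewrite e1 e2 !exprS; move: h1 h2; move: (2 * l + p + 2)%:R (2 * l + 3)%:R (2 ^+ l) => a b c a0 c0.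
by field; rewrite G2 G4 a0 c0.
Qed.

Lemma weyl_poly_coef m p S i : (weyl_poly m p S)`_i =
  if ~~ odd i && (i <= m.-1)%N then weyl_weight p i./2 * S`_i.+1 else 0.
Proof.
rewrite /weyl_poly coef_sum; under eq_bigr do rewrite coefZ coefXn.
case: ifP => [/andP[io im]|h]; last first.
  rewrite big1// => l _; rewrite (_ : (i == 2 * l)%N = false) ?mulr0//.
  by apply/negP => /eqP il; have := ltn_ord l; lia.
have il : (i./2 < (m.-1)./2.+1)%N by lia.
have i2 : (2 * i./2 = i)%N by lia.
rewrite (bigD1 (Ordinal il))//= i2 eqxx mulr1 big1 ?addr0// => l ln.
rewrite (_ : (i == 2 * l)%N = false) ?mulr0//.
apply/negP => /eqP iE; case/negP: ln; apply/eqP/val_inj => /=; lia.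
Qed.

Lemma size_weyl_poly m p S : (size (weyl_poly m p S) <= (2 * (m.-1)./2).+1)%N.
Proof.
apply/leq_sizeP => j mj; rewrite weyl_poly_coef.
by have -> : ~~ odd j && (j <= m.-1)%N = false by lia.
Qed.

(** As [q] is odd, the odd Steiner indices that survive are [q + 2j], with [l = h + j]. There the
    weight ratio is [(2(j+1) + q)/(2(j+1) + p + q - 1)]: it cancels the denominator of
    [gamma_ratio q] and replaces [q] by [p + q - 1]. *)
Lemma weyl_disk_steinerE (h n p : nat) : (0 < p)%N ->
  let q := (2 * h).+1 in
  weyl_poly (n + q) p (disk_steiner n q) =
  (weyl_weight p h * ball_coef 0 n * ball_coef 0 q) *:
    ('X^(2 * h) * (disk_even R (p + q - 1) n \Po 'X^2)).
Proof.
move=> p0 q; apply/polyP => i; rewrite weyl_poly_coef coefZ.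
have wE j : weyl_weight p (h + j) * ball_coef (2 * j) q =
    weyl_weight p h * ball_coef 0 q * gamma_ratio R (p + q - 1) j.
  rewrite ball_coef_even; elim: j => [|j IHj]; first by rewrite addn0 !gamma_ratio0 !mulr1.
  rewrite addnS weyl_weightS// !gamma_ratioS [RHS]mulrA -IHj.
  have -> : (2 * (h + j) + 3 = 2 * j.+1 + q)%N by rewrite /q; lia.
  have -> : (2 * (h + j) + p + 2 = 2 * j.+1 + (p + q - 1))%N by rewrite /q; lia.
  have h1 : (2 * j.+1 + q)%:R != 0 :> R by rewrite pnatr_eq0.
  have h2 : (2 * j.+1 + (p + q - 1))%:R != 0 :> R by rewrite pnatr_eq0.
  move: h1 h2; move: (2 * j.+1 + q)%:R (2 * j.+1 + (p + q - 1))%:R (2 * j.+1)%:R => a b c a0 b0.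
  by field; rewrite a0 b0.
case: (boolP (~~ odd i && (i <= (n + q).-1)%N)) => [/andP[io im]|hi].
  rewrite disk_steiner_coef coefXnM; case: ltnP => ih.
    have -> : (q <= i.+1)%N = false by rewrite /q; lia.
    by rewrite [LHS]mulr0 [RHS]mulr0.
  rewrite (_ : (q <= i.+1)%N); last by rewrite /q; lia.
  rewrite coef_comp_poly_Xn// disk_even_coef.
  have -> : (2 %| i - 2 * h)%N by lia.
  set j := ((i - 2 * h) %/ 2)%N.
  have -> : (i.+1 - q = 2 * j)%N by rewrite /q /j; lia.
  have -> : i./2 = (h + j)%N by rewrite /j; lia.
  move: (wE j); move: (weyl_weight _ _) (weyl_weight _ _) (ball_coef (2 * j) q)
    (ball_coef 0 q) (ball_coef 0 n) (gamma_ratio _ _ _) ('C(n, _)%:R) => w w' b b' b0 g c wb.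
  by rewrite mulrCA wb; ring.
rewrite coefXnM; case: ltnP => ih; first by rewrite mulr0.
rewrite coef_comp_poly_Xn//; case: ifP => [i2|_]; last by rewrite mulr0.
by rewrite disk_even_coef bin_small ?mul0r ?mulr0//; move: hi; rewrite /q; lia.
Qed.

End weyl.

(** * From roots of the limits to roots for small eps *)

Section limits.
Context {R : realType}.
Local Notation toC := (map_poly (real_complex R)).

(** [root_near] needs the exact degree. The top coefficient is a positive weight times a coefficient
    of [disk_steiner] with index between [q] and [n + q], which is positive. *)
Lemma size_weyl_disk_steiner n p q : odd q -> (0 < p)%N ->
  size (weyl_poly (n + q) p (@disk_steiner R n q)) = (2 * ((n + q).-1)./2).+1.
Proof.
move=> qo p0; apply/eqP; rewrite eqn_leq size_weyl_poly ltnNge.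
set m := (2 * _)%N; apply/negP => /leq_sizeP/(_ m (leqnn m)) /eqP.
have q0 := odd_gt0 qo.
rewrite weyl_poly_coef (_ : ~~ odd m && (m <= (n + q).-1)%N); last by rewrite /m; lia.
rewrite disk_steiner_coef (_ : (q <= m.+1)%N); last by rewrite /m; lia.
rewrite gt_eqF// mulr_gt0 ?weyl_weight_gt0// mulr_gt0 ?ball_coef_gt0//.
rewrite mulr_gt0 ?ball_coef_gt0// ltr0n bin_gt0 /m; lia.
Qed.

Lemma steiner_root_near n q (z0 d : R[i]) : root (toC (disk_steiner n q)) z0 -> 0 < d ->
  exists2 eps0 : R, 0 < eps0 & forall eps, 0 < eps <= eps0 ->
  forall S, is_steiner_polynomial (ellipsoid n q eps) S ->
  exists2 z, root (toC S) z & `|z - z0| < d.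
Proof.
move=> rz d0; have [e e0 He] := root_near (size_disk_steiner n q) rz d0.
have [eps0 eps00 Heps] := steiner_coef_cvg n q e0.
exists eps0 => // eps /Heps Hc S HS; apply: He; first by case: HS.
exact: Hc.
Qed.

Lemma weyl_root_near n p q (z0 d : R[i]) : odd q -> (0 < p)%N ->
  root (toC (weyl_poly (n + q) p (disk_steiner n q))) z0 -> 0 < d ->
  exists2 eps0 : R, 0 < eps0 & forall eps, 0 < eps <= eps0 ->
  forall W, is_weyl_polynomial p (ellipsoid n q eps) W ->
  exists2 z, root (toC W) z & `|z - z0| < d.
Proof.
move=> qo p0 rz d0.
have [e e0 He] := root_near (size_weyl_disk_steiner n qo p0) rz d0.
(* A common bound for the weights, so Steiner coefficients within [e / T] give Weyl coefficients
   within [e]. *)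
pose T : R := \sum_(l < ((n + q).-1)./2.+1) weyl_weight p l.
have wT l : (l < ((n + q).-1)./2.+1)%N -> weyl_weight p l <= T.
  move=> ll; rewrite /T (bigD1 (Ordinal ll))//= lerDl.
  by apply: sumr_ge0 => k _; rewrite ltW// weyl_weight_gt0.
have T0 : 0 < T by apply: lt_le_trans (wT 0%N isT); exact: weyl_weight_gt0.
have [eps0 eps00 Heps] := steiner_coef_cvg n q (divr_gt0 e0 T0).
exists eps0 => // eps /Heps Hc W /is_weyl_polyE[S HS ->].
apply: He; first exact: size_weyl_poly.
move=> k km; rewrite !weyl_poly_coef; case: ifP => [/andP[ko kn]|_]; last first.
  by rewrite subrr normr0 ltW.
have q0 := odd_gt0 qo.
rewrite -mulrBr normrM (gtr0_norm (weyl_weight_gt0 _ p0)).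
have -> : e = T * (e / T) by field; rewrite gt_eqF.
apply: ler_pM => //; first by rewrite ltW// weyl_weight_gt0.
  by apply: wT; lia.
by apply: Hc => //; lia.
Qed.

(** A square root of a root [z] of [disk_even] outside the nonpositive reals: were it purely
    imaginary, [z] would be [- y^2 <= 0]. *)
Lemma weyl_disk_steiner_root p q : odd q -> (0 < p)%N -> (6 <= p + q)%N ->
  exists N, forall n, (N <= n)%N ->
  exists2 z, root (toC (weyl_poly (n + q) p (disk_steiner n q))) z & complex.Re z != 0.
Proof.
move=> qo p0 pq; have [|N HN] := @disk_even_root R (p + q - 1); first by lia.
exists N => n /HN[z rz zn].
have qE : q = (2 * q./2).+1 by lia.
exists (sqrtC z); last first.
  apply: contra zn => /eqP w0; rewrite -(sqrtCK z) (complexE (sqrtC z)) w0 add0r.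
  by rewrite exprMn sqr_i mulN1r oppr_le0 -rmorphXn ler0c sqr_ge0.
rewrite qE weyl_disk_steinerE// -qE map_polyZ rootE hornerZ mulf_eq0.
apply/orP; right; rewrite -rootE.
rewrite rmorphM /= rootM map_comp_poly; apply/orP; right.
by rewrite map_polyXn rootE horner_comp hornerXn sqrtCK -rootE.
Qed.

End limits.

Theorem theorem2p12 (R : realType) :
  (forall q : nat, (5 <= q)%N ->
    exists N : nat, forall n : nat, (1 <= n)%N -> (N <= n)%N ->
    exists2 eps0 : R, 0 < eps0 &
    forall eps : R, 0 < eps <= eps0 ->
    forall S : {poly R}, is_steiner_polynomial (ellipsoid n q eps) S ->
      ~ dissipative (poly_to_complex S) /\
      exists2 z : R[i], root (poly_to_complex S) z & 0 < complex.Re z)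
  /\
  (forall p q : nat, odd q -> (1 <= p)%N -> (1 <= q)%N -> (6 <= p + q)%N ->
    exists N : nat, forall n : nat, (1 <= n)%N -> (N <= n)%N ->
    exists2 eps0 : R, 0 < eps0 &
    forall eps : R, 0 < eps <= eps0 ->
    forall W : {poly R}, is_weyl_polynomial p (ellipsoid n q eps) W ->
      ~ conservative (poly_to_complex W) /\
      exists2 z : R[i], root (poly_to_complex W) z & complex.Re z != 0).
Proof.
split=> [q q5|p q qo p1 q1 pq].
  have [N HN] := @disk_steiner_root R q q5; exists N => n n1 /(HN n n1)[z0 rz0 Rz0].
  have [|eps0 eps00 H] := steiner_root_near rz0 (d := `|complex.Re z0|%:C%C).
    by rewrite ltcR normr_gt0 gt_eqF.
  exists eps0 => // eps /H{}H S /H[z rz /near_Re[_ /(_ Rz0) Rz]].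
  by split; [move=> /(_ z rz); rewrite ltNge (ltW Rz)|exists z].
have [N HN] := @weyl_disk_steiner_root R p q qo p1 pq; exists N => n n1 /HN[z0 rz0 Rz0].
have [|eps0 eps00 H] := weyl_root_near qo p1 rz0 (d := `|complex.Re z0|%:C%C).
  by rewrite ltcR normr_gt0.
exists eps0 => // eps /H{}H W /H[z rz /near_Re[Rz _]].
by split; [move=> /(_ z rz)[/eqP]; rewrite (negPf Rz)|exists z].
Qed.
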